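(* Let $p$ be an odd prime and let $K\subset\mathbb{C}_p$ be a finite extension of $\mathbb{Q}_p$ with ramification index over $\mathbb{Q}_p$ less than $p-1$. Then $$T_p^a\left[\zeta_{p,E}(s,a)-\langle a\rangle^{1-s}\right]=\sum_{n=0}^\infty P_{p,n}^a(s)\exp_p(nD)\left[\zeta_{p,E}(s,a)-\langle a\rangle^{1-s}\right]$$ converges $p$-adically (that is, for each $n\geq 0$ the series in $k$ defining $\exp_p(nD)[\zeta_{p,E}(s,a)-\langle a\rangle^{1-s}]$ converges, and the resulting series over $n$ converges) for $s\in\mathbb{Z}_p$ with $s\neq1$ and $a\in K$ with $|a|_p>1$.
   Context: $p$ is an odd prime, $\mathbb{C}_p$ is the completion of an algebraic closure of $\mathbb{Q}_p$, with $|p|_p=1/p$ and valuation $v_p$, so $|x|_p=p^{-v_p(x)}$. Projections: fix an embedding of $\overline{\mathbb{Q}}$ into $\mathbb{C}_p$; for $r\in\mathbb{Q}$ let $p^r\in\mathbb{C}_p^\times$ denote the image of the positive real number $p^r$. Let $\mu$ be the group of roots of unity in $\mathbb{C}_p$ of order prime to $p$. For $|a|_p=1$, $\hat a\in\mu$ is the unique element with $|a-\hat a|_p<1$; for general $a\in\mathbb{C}_p^\times$, $\hat a:=\widehat{a/p^{v_p(a)}}$. Put $\omega_v(a)=p^{v_p(a)}\hat a$ and $\langle a\rangle=a/\omega_v(a)$, so that $|\langle a\rangle-1|_p<1$. For $s\in\mathbb{C}_p$, $\langle a\rangle^s=\sum_{n=0}^\infty\binom{s}{n}(\langle a\rangle-1)^n$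 whenever this converges (in particular for $s\in\mathbb{Z}_p$). Zeta function: for $a\in\mathbb{C}_p\setminus\mathbb{Z}_p$, the $p$-adic Hurwitz-type Euler zeta function is $$\zeta_{p,E}(s,a)=\int_{\mathbb{Z}_p}\langle a+t\rangle^{1-s}\,d\mu_{-1}(t),\qquad \int_{\mathbb{Z}_p}f(t)\,d\mu_{-1}(t):=\lim_{r\to\infty}\sum_{k=0}^{p^r-1}f(k)(-1)^k .$$ Operator: $T_p^a=\sum_{n=0}^\infty L_{p,n}^a$ with $L_{p,n}^a=P_{p,n}^a(s)\exp_p(nD)$, where $$P_{p,0}^a(s)=\frac{2}{s-1},\quad P_{p,1}^a(s)=\frac{1}{\omega_v(a)},\quad P_{p,n}^a(s)=\frac{1}{n!\,\omega_v^n(a)}\prod_{j=1}^{n-1}(s-1+j)\ (n\ge2),$$ $\omega_v^n(a)=\omega_v(a)^n$, and $\exp_p(nD)=\mathrm{id}+\sum_{k=1}^\infty\frac{n^k}{k!}D_s^k$ with $D_s^k=\frac{\partial^k}{\partial s^k}$, the derivatives being taken with respect to $s$ and evaluated at the given point $s$. *)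

(* Defs.v *)
From HB Require Import structures.
From mathcomp Require Import all_boot all_order all_algebra all_field.
From mathcomp Require Import all_classical all_reals all_analysis.

Set Implicit Arguments.
Unset Strict Implicit.
Unset Printing Implicit Defensive.

Import Order.TTheory GRing.Theory Num.Theory.

Local Open Scope classical_set_scope.
Local Open Scope ring_scope.

(* |x| = p^(-v x), with |0| = 0; the value [v 0] is irrelevant. *)
Definition valuation_norm (R : realType) (p : nat) (C : fieldType)
    (v : C -> rat) (x : C) : R :=
  if x == 0 then 0 else p%:R `^ (- ratr (v x)).

(* C_p, axiomatised up to isometric isomorphism: an algebraically closed field
   with a valuation normalised by |p| = 1/p, complete for the induced uniform
   structure, in which the elements algebraic over Q_p are dense. Here Q_p is
   the closure of the rationals. The valuation is rational valued because the
   value group of C_p is p^Q. *)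
HB.mixin Record isPadicComplex (R : realType) (p : nat) C
    of GRing.ClosedField C & Uniform C := {
  vp : C -> rat;
  vpM : forall x y : C, x != 0 -> y != 0 -> vp (x * y) = vp x + vp y;
  vpD : forall x y : C, x != 0 -> y != 0 -> x + y != 0 ->
    Num.min (vp x) (vp y) <= vp (x + y);
  norm_vp_p : valuation_norm R p vp (p%:R : C) = p%:R^-1;
  entourage_vp : (entourage : set_system (C * C)) =
    entourage_ (fun (x : C) (e : R) (y : C) =>
                  valuation_norm R p vp (x - y) < e);
  cauchy_vp_cvg : forall F : set_system C, ProperFilter F -> cauchy F ->
    exists l : C, F --> l;
  dense_algebraic : dense [set x : C | exists q : {poly C},
    [/\ q != 0,
        forall i, closure (range (ratr : rat -> C)) q`_i
      & root q x]]
}.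

#[short(type="padicComplexType")]
HB.structure Definition PadicComplex (R : realType) (p : nat) :=
  { C of isPadicComplex R p C & GRing.ClosedField C & Uniform C }.

Section PadicDefs.
Variables (R : realType) (p : nat) (C : padicComplexType R p).

Definition normp (x : C) : R := valuation_norm R p vp x.

Definition padic_rat : set C := closure (range ratr).

Definition padic_int : set C := [set x | padic_rat x /\ normp x <= 1].

Definition converges (u : nat -> C) : Prop := exists l : C, u @ \oo --> l.

(* The default value 0 is only reached when F does not converge. *)
Definition limit (F : set_system C) : C := xget 0 [set l | F --> l].

Definition series_sum (u : nat -> C) : C := limit (series u @ \oo).

Definition finite_extension (K : set C) : Prop :=
  [/\ divring_closed [in K],
      padic_rat `<=` K
    & exists (n : nat) (b : 'I_n -> C),
        K = [set x | exists2 c : 'I_n -> C,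
               forall i, padic_rat (c i) & x = \sum_i c i * b i]].

Definition value_group (K : set C) : set rat :=
  [set vp x | x in [set x | K x /\ x != 0]].

(* e is the index of the value group of Q_p in that of K. *)
Definition is_ramification_index (K : set C) (e : nat) : Prop :=
  ([set [set g + h | h in value_group padic_rat] | g in value_group K] #= `I_e)%card.

Section Projections.
(* The chosen embedding of the algebraic numbers into C_p. *)
Variable iota : {rmorphism algC -> C}.

(* The image of the positive real number p^r: the d-th root of p in algC is
   its nonnegative real one. *)
Definition ppow (r : rat) : C :=
  iota ((`|denq r|%N.-root (p%:R : algC)) ^ numq r).

Definition unity_prime_to_p : set C :=
  [set z | exists2 n : nat, coprime n p & n.-primitive_root z].

(* For |a| = 1 one has [vp a = 0], so that this covers both cases. *)
Definition teich (a : C) : C :=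
  xget 0 [set z | unity_prime_to_p z /\ normp (a / ppow (vp a) - z) < 1].

Definition omegav (a : C) : C := ppow (vp a) * teich a.

Definition ang (a : C) : C := a / omegav a.

Definition gbinom (s : C) (n : nat) : C :=
  (\prod_(i < n) (s - i%:R)) / n`!%:R.

Definition angpow (a s : C) : C :=
  series_sum (fun n => gbinom s n * (ang a - 1) ^+ n).

Definition int_mu_m1 (f : C -> C) : C :=
  limit ((fun r : nat => \sum_(0 <= k < p ^ r) f k%:R * (-1) ^+ k) @ \oo).

Definition zeta_pE (s a : C) : C :=
  int_mu_m1 (fun t => angpow (a + t) (1 - s)).

Definition Pcoef (n : nat) (a s : C) : C :=
  match n with
  | 0 => 2 / (s - 1)
  | 1 => (omegav a)^-1
  | _ => (n`!%:R * omegav a ^+ n)^-1 * \prod_(1 <= j < n) (s - 1 + j%:R)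
  end.

End Projections.

Definition diff_quot (f : C -> C) (s h : C) : C := (f (s + h) - f s) / h.

Definition derivablep (f : C -> C) (s : C) : Prop :=
  exists l : C, diff_quot f s @ dnbhs 0 --> l.

Definition Dp (f : C -> C) (s : C) : C := limit (diff_quot f s @ dnbhs 0).

Definition expD_term (n : nat) (f : C -> C) (s : C) (k : nat) : C :=
  n%:R ^+ k / k`!%:R * iter k Dp f s.

(* Since [Dp] is total, the convergence of the series exp_p(nD)[f] at s
   includes the existence, near s, of the derivatives that it involves. *)
Definition expD_converges (n : nat) (f : C -> C) (s : C) : Prop :=
  (forall k, \forall x \near s, derivablep (iter k Dp f) x) /\
  converges (series (expD_term n f s)).

Definition expD (n : nat) (f : C -> C) (s : C) : C :=
  series_sum (expD_term n f s).

End PadicDefs.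

(* Main.v *)
Require Import Defs.
From mathcomp Require Import all_boot all_order all_algebra all_field.
From mathcomp Require Import all_classical all_reals all_analysis.
From mathcomp Require Import ring.

(** Why the theorem holds.

    Write [x_k] for [ang iota (a + k) - 1]. Since [normp a > 1], the projection
    [omegav] takes the same value at [a] and at [a + k], so that
    [x_k = x_0 + k * u] with [u = (omegav iota a)^-1].

    The hypothesis on the ramification gives [normp (x_k) <= rho], where
    [rho = p^(-1/e)] is smaller than [p^(-1/(p-1))], the radius of convergence
    of the exponential. For [u] this is because the valuation of an element of
    [K] is a multiple of some [1/m] with [m <= e] ([ramification_gap]). For
    [x_0] it is less immediate, as [omegav iota a] need not lie in [K]: but the
    power of [ang iota a] with exponent [d * N], where [d] is the denominator
    of [vp a] and [N] the order of [teich iota a], does lie in [K], and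
    raising to this power, prime to [p], preserves the distance to [1]
    ([normp_ang_sub1_ramified]). That [teich iota a] exists at all means that
    residues are algebraic over the prime field; this comes from the density
    of the algebraic elements and a pigeonhole on the powers of a unit modulo
    the maximal ideal ([residue_root_of_unity]).

    The alternating sums of [x_k ^ n] over [k < p ^ r] converge as [r] grows,
    uniformly in [n], to moments [M n] with [normp (M n) <= rho ^ n]
    ([alternating_moments]); here [p] has to be odd. Hence, with
    [d n = M n - x_0 ^ n],

      [f (s + h) = sum over n of binomial (1 - s - h, n) * d n].

    Each binomial is a polynomial in [h] with coefficients of norm at most
    [1 / normp n!], which is at most [p^(n/(p-1))]. With
    [theta = rho * p^(1/(p-1)) < 1], the [n]th summand thus has coefficients of
    norm at most [theta ^ n], so that [f] is on the closed unit ball around [s]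
    a power series in [h] whose [m]th coefficient [c m] has norm at most
    [theta ^ m] ([zeta_minus_angpow_power_series]).

    Such a series can be differentiated term by term on the whole closed ball
    ([power_series_Dp]). The terms of exp_p(nD)[f] at [s] are then
    [n ^ k * c k], and their sum has norm at most 1 for every natural [n]
    ([expD_power_series]). As [Pcoef] decays like [theta ^ n]
    ([normp_Pcoef]), so do the terms of the outer series.

    All the convergence is geometric, and in an ultrametric a series with terms
    of norm at most [q ^ n] has remainders of norm at most [q ^ n]; the proof
    works with these exact remainders instead of limits wherever possible. *)

Set Implicit Arguments.
Unset Strict Implicit.
Unset Printing Implicit Defensive.

Import Order.TTheory GRing.Theory Num.Theory.
Import numFieldNormedType.Exports.

Local Open Scope classical_set_scope.
Local Open Scope ring_scope.

(** * The ultrametric norm *)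

Section PadicNorm.
Variables (R : realType) (p : nat) (C : padicComplexType R p).
Hypothesis hp : prime p.
Implicit Types x y z h eta u : C.

Lemma p_gt1R : 1 < p%:R :> R.
Proof. by rewrite ltr1n prime_gt1. Qed.

Lemma p_gt0R : 0 < p%:R :> R.
Proof. by rewrite ltr0n prime_gt0. Qed.

Lemma ler_p_powR (r t : R) : (p%:R `^ r <= p%:R `^ t :> R) = (r <= t).
Proof.
by rewrite -ler_ln ?posrE ?powR_gt0 ?p_gt0R// !ln_powR ler_pM2r// ln_gt0 ?p_gt1R.
Qed.

Lemma ltr_p_powR (r t : R) : (p%:R `^ r < p%:R `^ t :> R) = (r < t).
Proof. by rewrite !ltNge ler_p_powR. Qed.

Lemma normpE x : x != 0 -> normp x = p%:R `^ (- ratr (vp x)).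
Proof. by rewrite /normp /valuation_norm => /negbTE ->. Qed.

Lemma normp0 : normp (0 : C) = 0.
Proof. by rewrite /normp /valuation_norm eqxx. Qed.

Lemma normp_gt0 x : x != 0 -> 0 < normp x.
Proof. by move=> x0; rewrite normpE// powR_gt0// p_gt0R. Qed.

Lemma normp_ge0 x : 0 <= normp x.
Proof.
by have [->|/normp_gt0/ltW//] := eqVneq x 0; rewrite normp0.
Qed.

Lemma normp_eq0 x : (normp x == 0) = (x == 0).
Proof.
have [->|x0] := eqVneq x 0; first by rewrite normp0 eqxx.
by rewrite gt_eqF// normp_gt0.
Qed.

Lemma normpM x y : normp (x * y) = normp x * normp y.
Proof.
have [->|x0] := eqVneq x 0; first by rewrite mul0r normp0 mul0r.
have [->|y0] := eqVneq y 0; first by rewrite mulr0 normp0 mulr0.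
rewrite !normpE ?mulf_neq0// vpM// rmorphD opprD powRD//.
by apply/implyP => _; rewrite gt_eqF ?p_gt0R.
Qed.

Lemma normp1 : normp (1 : C) = 1.
Proof.
have h : normp (1 : C) != 0 by rewrite normp_eq0 oner_eq0.
by apply: (mulfI h); rewrite -normpM !mulr1.
Qed.

Lemma normpX x n : normp (x ^+ n) = normp x ^+ n.
Proof.
by elim: n => [|n IH]; rewrite ?expr0 ?normp1// !exprS normpM IH.
Qed.

Lemma normpV x : normp x^-1 = (normp x)^-1.
Proof.
have [->|x0] := eqVneq x 0; first by rewrite invr0 normp0 invr0.
have h : normp x != 0 by rewrite normp_eq0.
by apply: (mulfI h); rewrite -normpM !divff// normp1.
Qed.

Lemma normpN x : normp (- x) = normp x.
Proof.
rewrite -mulN1r normpM; suff -> : normp (-1 : C) = 1 by rewrite mul1r.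
apply/eqP; rewrite -(@eqrXn2 _ 2)// ?normp_ge0// expr1n.
by rewrite -normpX sqrrN expr1n normp1.
Qed.

Lemma normpBC x y : normp (x - y) = normp (y - x).
Proof. by rewrite -normpN opprB. Qed.

Lemma normpD_max x y : normp (x + y) <= Num.max (normp x) (normp y).
Proof.
have [->|x0] := eqVneq x 0; first by rewrite add0r le_max lexx orbT.
have [->|y0] := eqVneq y 0; first by rewrite addr0 le_max lexx.
have [->|xy0] := eqVneq (x + y) 0; first by rewrite normp0 le_max normp_ge0.
rewrite !normpE// le_max; have := vpD _ _ x0 y0 xy0.
have mono (a b : rat) : a <= b ->
    (p%:R : R) `^ (- ratr b) <= p%:R `^ (- ratr a).
  by move=> ab; apply: ler_powR; rewrite ?lerN2 ?ler_rat// ltW// p_gt1R.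
by rewrite ge_min => /orP[] /mono ->; rewrite ?orbT.
Qed.

Lemma normpD_le x y e : normp x <= e -> normp y <= e -> normp (x + y) <= e.
Proof.
by move=> xe ye; apply: le_trans (normpD_max _ _) _; rewrite ge_max xe.
Qed.

Lemma normpD_lt x y e : normp x < e -> normp y < e -> normp (x + y) < e.
Proof.
by move=> xe ye; apply: le_lt_trans (normpD_max _ _) _; rewrite gt_max xe.
Qed.

Lemma normpB_le x y e : normp x <= e -> normp y <= e -> normp (x - y) <= e.
Proof. by move=> xe ye; apply: normpD_le; rewrite ?normpN. Qed.

Lemma normpB_lt x y e : normp x < e -> normp y < e -> normp (x - y) < e.
Proof. by move=> xe ye; apply: normpD_lt; rewrite ?normpN. Qed.

Lemma normp_trans_le y x z e :
  normp (x - y) <= e -> normp (y - z) <= e -> normp (x - z) <= e.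
Proof. by move=> xy yz; rewrite -(subrKA y); apply: normpD_le. Qed.

Lemma normp_trans_lt y x z e :
  normp (x - y) < e -> normp (y - z) < e -> normp (x - z) < e.
Proof. by move=> xy yz; rewrite -(subrKA y); apply: normpD_lt. Qed.

Lemma normp_sum_le (I : Type) (r : seq I) (P : pred I) (F : I -> C) e :
  0 <= e -> (forall i, P i -> normp (F i) <= e) ->
  normp (\sum_(i <- r | P i) F i) <= e.
Proof.
move=> e0 Fe; elim/big_ind: _ => //; first by rewrite normp0.
by move=> *; exact: normpD_le.
Qed.

Lemma normp_sum_lt (I : Type) (r : seq I) (P : pred I) (F : I -> C) e :
  0 < e -> (forall i, P i -> normp (F i) < e) ->
  normp (\sum_(i <- r | P i) F i) < e.
Proof.
move=> e0 Fe; elim/big_ind: _ => //; first by rewrite normp0.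
by move=> *; exact: normpD_lt.
Qed.

Lemma normp_prod (I : Type) (r : seq I) (P : pred I) (F : I -> C) :
  normp (\prod_(i <- r | P i) F i) = \prod_(i <- r | P i) normp (F i).
Proof. by apply: (big_morph _ normpM normp1). Qed.

Lemma normp_prod_le1 (I : Type) (r : seq I) (P : pred I) (F : I -> C) :
  (forall i, P i -> normp (F i) <= 1) ->
  normp (\prod_(i <- r | P i) F i) <= 1.
Proof.
move=> Fe; elim/big_ind: _ => //; first by rewrite normp1.
by move=> x y x1 y1; rewrite normpM mulr_ile1 ?normp_ge0.
Qed.

(** In an ultrametric, all triangles are isosceles. *)
Lemma normp_isosceles x y : normp (x - y) < normp y -> normp x = normp y.
Proof.
move=> xy; apply/eqP; rewrite eq_le; apply/andP; split.
  by rewrite -(subrK y x) normpD_le// ltW.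
rewrite leNgt; apply/negP => xlty.
have : normp (x - (x - y)) < normp y by apply: normpB_lt.
by rewrite opprB addrC subrK ltxx.
Qed.

Lemma normp_nat_le1 n : normp (n%:R : C) <= 1.
Proof.
elim: n => [|n IH]; first by rewrite normp0 ler01.
by rewrite -natr1 normpD_le// normp1.
Qed.

Lemma normp_p : normp (p%:R : C) = p%:R^-1.
Proof. exact: norm_vp_p. Qed.

Lemma p_neq0 : (p%:R : C) != 0.
Proof. by rewrite -normp_eq0 normp_p invr_eq0 gt_eqF// p_gt0R. Qed.

Lemma normp_p_lt1 : normp (p%:R : C) < 1.
Proof. by rewrite normp_p invf_lt1 ?p_gt1R ?p_gt0R. Qed.

Lemma vp_p : vp (p%:R : C) = 1.
Proof.
have := normp_p; rewrite normpE ?p_neq0// -powR_inv1 ?ler0n// => /eqP.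
rewrite eq_le !ler_p_powR -eq_le eqr_opp -(rmorph1 (@ratr R)) => /eqP.
exact: fmorph_inj.
Qed.

Lemma normp_dvdn n : (p %| n)%N -> normp (n%:R : C) < 1.
Proof.
move=> /dvdnP[k ->]; rewrite natrM normpM.
apply: le_lt_trans normp_p_lt1.
by rewrite ler_piMl ?normp_ge0 ?normp_nat_le1.
Qed.

(** By Bezout such an [n] divides 1 modulo [p], so that [normp n < 1] would
    force [normp 1 < 1]. *)
Lemma normp_ndvdn n : ~~ (p %| n)%N -> normp (n%:R : C) = 1.
Proof.
move=> pn; apply/eqP; rewrite eq_le normp_nat_le1/= leNgt; apply/negP => n1.
have n0 : (0 < n)%N by case: n pn {n1} => //; rewrite dvdn0.
have [u v uv _ ] := egcdnP p n0.
have np : coprime n p by rewrite coprime_sym prime_coprime.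
have : normp ((u * n)%:R - (v * p)%:R : C) < 1.
  apply: normpB_lt; last by rewrite normp_dvdn ?dvdn_mull.
  rewrite natrM normpM; apply: le_lt_trans n1.
  by rewrite ler_piMl ?normp_ge0 ?normp_nat_le1.
by rewrite uv (eqP np) natrD addrAC subrr add0r normp1 ltxx.
Qed.


(** * Limits and geometric series *)

Lemma nbhs_normpP x (A : set C) :
  nbhs x A <-> exists2 e : R, 0 < e & forall y, normp (x - y) < e -> A y.
Proof.
rewrite -nbhs_entourageE entourage_vp; split.
  move=> [E [e /= e0 eE] EA]; exists e => // y xy; apply: EA.
  by rewrite /xsection /= inE; exact: eE.
move=> [e e0 eA].
exists [set xy : C * C | normp (xy.1 - xy.2) < e]; first by exists e.
by move=> y; rewrite /xsection /= inE /=; exact: eA.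
Qed.

Lemma cvg_normpP (F : set_system C) (l : C) : Filter F ->
  F --> l <-> forall e : R, 0 < e -> F [set y | normp (l - y) < e].
Proof.
move=> FF; split=> [Fl e e0|Fl A /nbhs_normpP[e e0 eA]].
  by apply: Fl; apply/nbhs_normpP; exists e.
by apply: filterS (Fl e e0) => y; exact: eA.
Qed.

(** The value of [limit] is a choice among the limits, so that computing it
    rests on their uniqueness. *)
Lemma limitE (F : set_system C) (l : C) : ProperFilter F -> F --> l ->
  limit F = l.
Proof.
move=> FF Fl; rewrite /limit.
case: xgetP => [y _ /= Fy|/(_ l)//].
apply/eqP; rewrite -subr_eq0 -normp_eq0; apply: contraT => yl.
have yl0 : 0 < normp (y - l) by rewrite lt_neqAle eq_sym yl normp_ge0.
have [z [/= yz lz]] : (exists z, normp (y - z) < normp (y - l)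
                             /\ normp (l - z) < normp (y - l)).
  apply: (@filter_ex _ F); apply: filterI.
    by move/cvg_normpP: Fy; exact.
  by move/cvg_normpP: Fl; exact.
have := normp_trans_lt yz (_ : normp (z - l) < normp (y - l)).
by rewrite normpBC lz ltxx => /(_ isT).
Qed.

Lemma cvg_seq_normpP (u : nat -> C) (l : C) :
  u @ \oo --> l <-> forall e : R, 0 < e ->
    exists N, forall n, (N <= n)%N -> normp (l - u n) < e.
Proof.
split=> [/cvg_normpP ul e /ul|ul].
  by rewrite nbhs_simpl => -[N _ uN]; exists N => n Nn; exact: uN.
apply/cvg_normpP => e /ul[N uN].
by exists N => // n /= Nn; exact: uN.
Qed.

Lemma exp_small (q e : R) : 0 <= q < 1 -> 0 < e ->
  exists N, forall n, (N <= n)%N -> q ^+ n < e.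
Proof.
move=> /andP[q0 q1] e0.
have /cvgrPdist_lt/(_ e e0)[N _ h] : (fun n => q ^+ n) @ \oo --> (0 : R).
  by apply: cvg_expr; rewrite ger0_norm.
exists N => n Nn; have := h n Nn.
by rewrite /= sub0r normrN ger0_norm// exprn_ge0.
Qed.

Lemma cvg_geom (u : nat -> C) l (q : R) : 0 <= q < 1 ->
  (forall n, normp (l - u n) <= q ^+ n) -> u @ \oo --> l.
Proof.
move=> q01 ul; apply/cvg_seq_normpP => e /(exp_small q01)[N h].
by exists N => n /h; exact: le_lt_trans.
Qed.

(** In an ultrametric, steps of size [q ^ n] add up to a remainder of size
    [q ^ n], without the constant [1 / (1 - q)]. *)
Lemma cauchy_geom (u : nat -> C) (q : R) : 0 <= q < 1 ->
  (forall n, normp (u n.+1 - u n) <= q ^+ n) ->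
  exists l, forall n, normp (l - u n) <= q ^+ n.
Proof.
move=> /[dup] q01 /andP[q0 q1] uq.
have mono n m : (n <= m)%N -> normp (u m - u n) <= q ^+ n.
  elim: m => [|m IH]; first by rewrite leqn0 => /eqP->; rewrite subrr normp0 exprn_ge0.
  rewrite leq_eqVlt ltnS => /predU1P[->|nm].
    by rewrite subrr normp0 exprn_ge0.
  apply: (@normp_trans_le (u m)); last exact: IH.
  by apply: le_trans (uq m) _; apply: ler_wiXn2l => //; apply: ltW.
have : cauchy (u @ \oo).
  rewrite /cauchy entourage_vp => A [e /= e0 eA].
  have [N h] := exp_small q01 e0.
  exists ([set x | normp (x - u N) <= q ^+ N], [set x | normp (x - u N) <= q ^+ N]).
    by split=> /=; exists N => // n /= Nn; exact: mono.
  move=> [x y] /= [xN yN]; apply: eA => /=.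
  apply: le_lt_trans (h N (leqnn N)).
  by apply: normp_trans_le xN _; rewrite normpBC.
move=> /cauchy_vp_cvg[l /cvg_seq_normpP ul]; exists l => n.
rewrite leNgt; apply/negP => h.
have [N /(_ (maxn N n) (leq_maxl _ _)) lN] :=
  ul _ (le_lt_trans (exprn_ge0 n q0) h).
have := le_lt_trans (mono n (maxn N n) (leq_maxr _ _)) h.
by move/(normp_trans_lt lN); rewrite ltxx.
Qed.

Lemma series_geom (u : nat -> C) (q : R) : 0 <= q < 1 ->
  (forall n, normp (u n) <= q ^+ n) ->
  exists l, forall n, normp (l - series u n) <= q ^+ n.
Proof.
move=> q01 uq; apply: cauchy_geom => // n.
by rewrite /series /= big_nat_recr//= addrAC subrr add0r.
Qed.

Lemma series_geom_cvg (u : nat -> C) (q : R) : 0 <= q < 1 ->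
  (forall n, normp (u n) <= q ^+ n) -> converges (series u).
Proof.
move=> q01 /(series_geom q01)[l lu]; exists l; exact: cvg_geom lu.
Qed.

Lemma series_sumE (u : nat -> C) l (q : R) : 0 <= q < 1 ->
  (forall n, normp (l - series u n) <= q ^+ n) -> series_sum u = l.
Proof. by move=> q01 ul; apply: limitE; exact: cvg_geom ul. Qed.

Lemma series_sum_geom (u : nat -> C) (q : R) : 0 <= q < 1 ->
  (forall n, normp (u n) <= q ^+ n) ->
  forall n, normp (series_sum u - series u n) <= q ^+ n.
Proof. by move=> q01 /(series_geom q01)[l lu]; rewrite (series_sumE q01 lu). Qed.

(** The way in which the identity of two sums is read off from estimates of
    their common partial sums. *)
Lemma normp_eq_geom x y (q : R) : 0 <= q < 1 ->
  (forall n, normp (x - y) <= q ^+ n) -> x = y.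
Proof.
move=> q01 h; apply/eqP; rewrite -subr_eq0 -normp_eq0 eq_le normp_ge0 andbT.
rewrite leNgt; apply/negP => /(exp_small q01)[N /(_ N (leqnn N))].
by rewrite ltNge h.
Qed.

(** The powers of [p] witness that the topology is not discrete; without this,
    a derivative would not be determined by its difference quotients. *)
Lemma dnbhs0_proper : ProperFilter (dnbhs (0 : C)).
Proof.
apply: Build_ProperFilter_ex => A; rewrite /dnbhs /within /=.
move=> /nbhs_normpP[e e0 eA].
have q01 : 0 <= normp (p%:R : C) < 1 by rewrite normp_ge0 normp_p_lt1.
have [N /(_ N (leqnn N)) h] := exp_small q01 e0.
exists (p%:R ^+ N); apply: eA; last by rewrite expf_neq0// p_neq0.
by rewrite sub0r normpN normpX.
Qed.

(** * Differentiating power series *)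

Lemma normp_nat n : (0 < n)%N -> normp (n%:R : C) = p%:R^-1 ^+ logn p n.
Proof.
move=> n0; have [m pm nE] := pfactor_coprime hp n0.
have m0 : (0 < m)%N by case: m pm {nE} => //; rewrite prime_coprime// dvdn0.
rewrite {1}nE natrM natrX normpM normpX normp_p normp_ndvdn ?mul1r//.
by rewrite -prime_coprime.
Qed.

Lemma natr_neq0 n : (0 < n)%N -> (n%:R : C) != 0.
Proof.
move=> n0; rewrite -normp_eq0 normp_nat// expf_neq0// invr_eq0.
by rewrite gt_eqF// p_gt0R.
Qed.

(** The bound by [q ^ N] on the remainders is what makes this notion stable
    under term-by-term differentiation without shrinking the ball. *)
Definition power_series_at (f : C -> C) (x0 : C) (c : nat -> C) (q : R) :=
  forall h, normp h <= 1 ->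
  forall N, normp (f (x0 + h) - \sum_(m < N) c m * h ^+ m) <= q ^+ N.

Definition deriv_coef (c : nat -> C) (m : nat) : C := m.+1%:R * c m.+1.

(** The remainder of order two has integral coefficients. This makes the
    difference quotients of [h ^+ m] converge uniformly in [m]. *)
Lemma exprD_taylor2 h eta m : normp h <= 1 -> normp eta <= 1 ->
  exists2 z, normp z <= 1 &
    (h + eta) ^+ m.+1 = h ^+ m.+1 + m.+1%:R * h ^+ m * eta + eta ^+ 2 * z.
Proof.
move=> h1 eta1; elim: m => [|m [z z1 IH]].
  exists 0; first by rewrite normp0 ler01.
  by rewrite mulr0 addr0 !expr1 expr0 mulr1 mul1r.
exists (z * (h + eta) + m.+1%:R * h ^+ m).
  apply: normpD_le; rewrite normpM mulr_ile1 ?normp_ge0//.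
  - exact: normpD_le.
  - exact: normp_nat_le1.
  - by rewrite normpX exprn_ile1 ?normp_ge0.
rewrite exprSr IH [in RHS]exprS [m.+2%:R]mulrS [h ^+ m.+1]exprS.
by ring.
Qed.

(** For given [eta] the series is cut at an [N] with
    [q ^+ N < normp eta ^+ 2], so that the remainders stay negligible after the
    division by [eta]; on the partial sums, [exprD_taylor2] bounds the error by
    [normp eta]. *)
Lemma power_series_diff_quot (f : C -> C) x0 c q h : 0 <= q < 1 ->
  (forall m, normp (c m) <= q ^+ m) -> power_series_at f x0 c q ->
  normp h <= 1 ->
  exists2 l, diff_quot f (x0 + h) @ dnbhs 0 --> l &
    forall N, normp (l - \sum_(m < N) deriv_coef c m * h ^+ m) <= q ^+ N.
Proof.
move=> /[dup] q01 /andP[q0 q1] cq fc h1.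
have hX m : normp (h ^+ m) <= 1 by rewrite normpX exprn_ile1 ?normp_ge0.
have c1 m : normp (c m) <= 1.
  by apply: le_trans (cq m) _; apply: exprn_ile1 => //; apply: ltW.
have dq m : normp (deriv_coef c m * h ^+ m) <= q ^+ m.
  rewrite !normpM -mulrA mulrCA; apply: le_trans (_ : q ^+ m.+1 * 1 <= _).
    by rewrite ler_pM ?mulr_ge0 ?normp_ge0 ?mulr_ile1 ?normp_ge0 ?normp_nat_le1.
  by rewrite mulr1 exprS ler_piMl ?exprn_ge0// ltW.
have [l lE] := series_geom q01 dq.
have {}lE N : normp (l - \sum_(m < N) deriv_coef c m * h ^+ m) <= q ^+ N.
  by have := lE N; rewrite /series /= big_mkord.
exists l => //; have F := dnbhs0_proper.
apply/cvg_normpP => e e0; rewrite /= /dnbhs /within /=.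
apply/nbhs_normpP; exists (Num.min e 1); first by rewrite lt_min e0 ltr01.
move=> eta; rewrite sub0r normpN lt_min => /andP[etae /ltW eta1] eta0.
apply: le_lt_trans etae; have eta_gt0 := normp_gt0 eta0.
have [N /(_ N (leqnn N)) qN] := exp_small q01 (exprn_gt0 2 eta_gt0).
have qN' : q ^+ N.+1 <= normp eta ^+ 2.
  by apply: le_trans (ltW qN); rewrite exprS ler_piMl ?exprn_ge0// ltW.
have /boolp.choice[z zP] : forall m, exists z, normp z <= 1 /\
    (h + eta) ^+ m.+1 = h ^+ m.+1 + m.+1%:R * h ^+ m * eta + eta ^+ 2 * z.
  by move=> m; have [z z1 zE] := exprD_taylor2 m h1 eta1; exists z.
set T := \sum_(m < N) deriv_coef c m * h ^+ m.
set Z := \sum_(m < N) c m.+1 * z m.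
have ZE : \sum_(m < N.+1) c m * (h + eta) ^+ m - \sum_(m < N.+1) c m * h ^+ m
            = eta * (T + eta * Z).
  rewrite -sumrB big_ord_recl /= !expr0 subrr add0r mulrDr mulrA -expr2.
  rewrite /T /Z !mulr_sumr -big_split /=; apply: eq_bigr => m _.
  rewrite /bump /= add1n (zP m).2 /deriv_coef; ring.
have Z1 : normp Z <= 1.
  by apply: normp_sum_le => // m _; rewrite normpM mulr_ile1 ?normp_ge0// (zP m).1.
have heta1 : normp (h + eta) <= 1 by apply: normpD_le.
have := fc _ heta1 N.+1; have := fc _ h1 N.+1.
set A := f (x0 + h); set B := f _.
set A' := \sum_(m < _) _; set B' := \sum_(m < _) _ in ZE * => AA' BB'.
have -> : l - diff_quot f (x0 + h) eta
        = (l - T) - (((B - B') - (A - A')) / eta + eta * Z).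
  have BA : B' - A' = eta * (T + eta * Z) by rewrite -ZE.
  rewrite /diff_quot -addrA -/A -/B.
  rewrite (_ : B - B' - (A - A') = B - A - (B' - A')); last by ring.
  by rewrite BA; field.
apply: normpB_le.
  apply: le_trans (lE N) _; apply: le_trans (ltW qN) _.
  by rewrite expr2 ler_piMl ?normp_ge0.
apply: normpD_le; last by rewrite normpM ler_piMr ?normp_ge0.
rewrite normpM normpV ler_pdivrMr// -expr2.
by apply: le_trans qN'; apply: normpB_le.
Qed.

Lemma power_series_Dp (f : C -> C) x0 c q : 0 <= q < 1 ->
  (forall m, normp (c m) <= q ^+ m) -> power_series_at f x0 c q ->
  power_series_at (Dp f) x0 (deriv_coef c) q.
Proof.
move=> q01 cq fc h h1; have [l fl lE] := power_series_diff_quot q01 cq fc h1.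
by rewrite /Dp (limitE _ fl) //; exact/fmap_proper_filter/dnbhs0_proper.
Qed.

Lemma deriv_coef_geom (c : nat -> C) (q : R) : 0 <= q < 1 ->
  (forall m, normp (c m) <= q ^+ m) -> forall m, normp (deriv_coef c m) <= q ^+ m.
Proof.
move=> /andP[q0 q1] cq m; apply: le_trans (_ : q ^+ m.+1 <= _).
  rewrite normpM; apply: le_trans (cq _).
  by rewrite ler_piMl ?normp_ge0 ?normp_nat_le1.
by rewrite exprS ler_piMl ?exprn_ge0// ltW.
Qed.

Lemma iter_deriv_coef k (c : nat -> C) m :
  iter k deriv_coef c m = ((m + k) ^_ k)%:R * c (m + k)%N.
Proof.
elim: k m => [|k IH] m; first by rewrite addn0 ffactn0 mul1r.
rewrite iterS /deriv_coef IH mulrA -natrM addSnnS ffactnSr.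
by rewrite mulnC addnS subSn ?leq_addl// addnK.
Qed.

Lemma iter_Dp_power_series (f : C -> C) x0 c q k : 0 <= q < 1 ->
  (forall m, normp (c m) <= q ^+ m) -> power_series_at f x0 c q ->
  (forall m, normp (iter k deriv_coef c m) <= q ^+ m) /\
  power_series_at (iter k (@Dp R p C) f) x0 (iter k deriv_coef c) q.
Proof.
move=> q01 cq fc; elim: k => // k [IH1 IH2]; split => /=.
  exact: deriv_coef_geom.
exact: power_series_Dp.
Qed.

(** Since [iter k Dp f] is the [k]th derivative on the whole ball, its value at
    the centre is [k! * c k], and the factorial cancels. The bound on [expD] is
    uniform in [n] because natural numbers have norm at most 1. *)
Lemma expD_power_series (f : C -> C) x0 c q n : 0 <= q < 1 ->
  (forall m, normp (c m) <= q ^+ m) -> power_series_at f x0 c q ->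
  expD_converges n f x0 /\ normp (expD n f x0) <= 1.
Proof.
move=> q01 cq fc.
have termE k : expD_term n f x0 k = n%:R ^+ k * c k.
  have [_ /(_ 0)] := iter_Dp_power_series k q01 cq fc.
  rewrite addr0 normp0 ler01 => /(_ isT) h.
  rewrite /expD_term (_ : iter k (@Dp R p C) f x0 = k`!%:R * c k).
    by rewrite mulrA divfK// natr_neq0// fact_gt0.
  apply: (normp_eq_geom q01) => N.
    (* For N = 0 the partial sum is empty and does not contain the constant
       term; the estimate for N = 1 is stronger. *)
  case: N => [|N].
    have := h 1%N; rewrite big_ord1 expr0 mulr1 iter_deriv_coef add0n ffactnn.
    by move/le_trans; apply; rewrite expr1; case/andP: q01 => _ /ltW.
  have := h N.+1; rewrite big_ord_recl big1 => [|i _]; last by rewrite expr0n mulr0.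
  by rewrite addr0 expr0 mulr1 iter_deriv_coef add0n ffactnn.
have termq k : normp (expD_term n f x0 k) <= q ^+ k.
  rewrite termE normpM; apply: le_trans (cq k).
  by rewrite ler_piMl ?normp_ge0// normpX exprn_ile1 ?normp_ge0 ?normp_nat_le1.
split; last first.
  have := series_sum_geom q01 termq 0%N.
  by rewrite /series /= big_geq// subr0 expr0.
split; last exact: series_geom_cvg termq.
move=> k; apply/nbhs_normpP; exists 1 => // y xy.
have [kq kf] := iter_Dp_power_series k q01 cq fc.
have h1 : normp (y - x0) <= 1 by rewrite normpBC ltW.
have [l fl _] := power_series_diff_quot q01 kq kf h1.
by exists l; rewrite addrC subrK in fl.
Qed.

(** * Factorials, binomials and alternating sums *)

(** In Legendre's formula, [p * (n %/ p ^ k.+1) <= n %/ p ^ k], and the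
    differences telescope. *)
Lemma logn_fact_le n : (p.-1 * logn p n`! <= n)%N.
Proof.
(* Stopping the telescoping at [m] leaves the term [n %/ p ^ m]. *)
suff h m : (p.-1 * (\sum_(1 <= k < m.+1) n %/ p ^ k) + n %/ p ^ m <= n)%N.
  by rewrite logn_fact//; apply: leq_trans (h n); apply: leq_addr.
elim: m => [|m IH]; first by rewrite big_geq// muln0 add0n expn0 divn1.
rewrite big_nat_recr//= mulnDr -addnA; apply: leq_trans IH.
rewrite leq_add2l -[X in (_ * X + X)%N]mul1n !mul1n.
rewrite -[X in (_ + X)%N]mul1n -mulnDl addn1 prednK ?prime_gt0//.
by rewrite expnSr divnMA mulnC leq_trunc_div.
Qed.

(** The reciprocal of the radius of convergence of the exponential. *)
Definition exp_rate : R := p%:R `^ (p.-1%:R^-1).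

Lemma exp_rate_gt0 : 0 < exp_rate.
Proof. by rewrite powR_gt0// p_gt0R. Qed.

Lemma exp_rate_ge1 : 1 <= exp_rate.
Proof.
by rewrite -(powRr0 (p%:R : R)) ler_powR ?invr_ge0 ?ler0n// ltW// p_gt1R.
Qed.

Lemma normp_fact_inv n : normp ((n`!%:R : C)^-1) <= exp_rate ^+ n.
Proof.
have p1 : (0 < p.-1)%N by have := prime_gt1 hp; case: p => [|[]].
rewrite normpV normp_nat ?fact_gt0// exprVn invrK.
rewrite -(powR_mulrn _ (ler0n R p)) -(powR_mulrn n (ltW exp_rate_gt0)).
rewrite /exp_rate -powRrM ler_powR ?(ltW p_gt1R)//.
by rewrite mulrC ler_pdivlMr ?ltr0n// -natrM ler_nat mulnC logn_fact_le.
Qed.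

(** The numerator has norm at most 1; only the factorial in the denominator
    counts. *)
Lemma normp_gbinom y n : normp y <= 1 -> normp (gbinom y n) <= exp_rate ^+ n.
Proof.
move=> y1; rewrite /gbinom normpM mulrC.
rewrite -[leRHS]mulr1 ler_pM ?normp_ge0 ?normp_fact_inv//.
by apply: normp_prod_le1 => i _; apply: normpB_le => //; apply: normp_nat_le1.
Qed.

Lemma normp_exprB x y n : normp x <= 1 -> normp y <= 1 ->
  normp (x ^+ n - y ^+ n) <= normp (x - y).
Proof.
move=> x1 y1; rewrite subrXX normpM ler_piMr ?normp_ge0//.
apply: normp_sum_le => // i _.
by rewrite normpM mulr_ile1 ?normp_ge0// normpX exprn_ile1 ?normp_ge0.
Qed.

(** Because [q] is odd, the block of the [k] with [i * q <= k < i.+1 * q]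
    contributes, up to [e], the sum over the first block times [(-1) ^ i]; over
    an odd number of blocks all these contributions but one cancel. *)
Lemma alternating_sum_odd_blocks (g : nat -> C) (q j : nat) (e : R) : 0 <= e ->
  odd q -> odd j -> (forall i k, normp (g (i * q + k)%N - g k) <= e) ->
  normp (\sum_(0 <= k < j * q) g k * (-1) ^+ k
         - \sum_(0 <= k < q) g k * (-1) ^+ k) <= e.
Proof.
move=> e0 qo jo ge; set S := \sum_(0 <= k < q) _.
have sgn n : normp ((-1 : C) ^+ n) <= 1.
  by rewrite normpX normpN normp1 expr1n.
(* After [i] blocks the sum is [S] or 0, according to the parity of [i]. *)
suff h i : normp (\sum_(0 <= k < i * q) g k * (-1) ^+ k - (odd i)%:R * S) <= e.
  by have := h j; rewrite jo mul1r.
elim: i => [|i IH]; first by rewrite mul0n big_geq// mul0r subrr normp0.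
rewrite mulSnr (big_cat_nat (n := (i * q)%N)) ?leq_addr//=.
rewrite -{2}[(i * q)%N]add0n big_addn addKn.
have -> : (~~ odd i)%:R * S = (odd i)%:R * S + (-1) ^+ i * S.
  rewrite -(signr_odd C i); case: (odd i) => /=; ring.
rewrite opprD addrACA; apply: normpD_le => //.
rewrite /S mulr_sumr -sumrB; apply: normp_sum_le => // k _.
have sgnq : (-1 : C) ^+ (i * q) = (-1) ^+ i.
  by rewrite mulnC exprM -(signr_odd C q) qo expr1.
have -> : g (k + i * q)%N * (-1) ^+ (k + i * q) - (-1) ^+ i * (g k * (-1) ^+ k)
       = (g (i * q + k)%N - g k) * ((-1) ^+ i * (-1) ^+ k).
  by rewrite exprD sgnq addnC; ring.
by rewrite normpM -exprD; apply: le_trans (ge i k); rewrite ler_piMr ?normp_ge0.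
Qed.

(** Passing from [p ^ r] to [p ^ r.+1] replaces the sum by one over [p] blocks
    of length [p ^ r], on each of which the summands are the same modulo
    [p ^ r]. *)
Lemma alternating_moments (x0 u : C) (rho : R) : odd p -> 0 < rho <= 1 ->
  normp x0 <= rho -> normp u <= rho ->
  exists M : nat -> C, forall n, normp (M n) <= rho ^+ n /\
    forall r, normp (M n - \sum_(0 <= k < p ^ r) (x0 + k%:R * u) ^+ n * (-1) ^+ k)
      <= p%:R^-1 ^+ r.
Proof.
move=> hodd /andP[rho0 rho1] x0r ur.
have q01 : 0 <= (p%:R^-1 : R) < 1.
  by rewrite invr_ge0 ler0n invf_lt1 ?p_gt0R ?p_gt1R.
have q0 : 0 <= (p%:R^-1 : R) by case/andP: q01.
have u1 : normp u <= 1 by apply: le_trans rho1.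
have xr k : normp (x0 + k%:R * u) <= rho.
  apply: normpD_le => //; rewrite normpM; apply: le_trans ur.
  by rewrite ler_piMl ?normp_ge0 ?normp_nat_le1.
have x1 k : normp (x0 + k%:R * u) <= 1 by apply: le_trans (xr k) _.
pose S n r := \sum_(0 <= k < p ^ r) (x0 + k%:R * u) ^+ n * (-1) ^+ k.
have Sr n r : normp (S n r) <= rho ^+ n.
  apply: normp_sum_le => [|k _]; first by rewrite exprn_ge0// ltW.
  rewrite normpM !normpX normpN normp1 expr1n mulr1.
  by rewrite lerXn2r ?nnegrE ?normp_ge0// ltW.
have SS n r : normp (S n r.+1 - S n r) <= p%:R^-1 ^+ r.
  rewrite /S expnS.
  apply: (@alternating_sum_odd_blocks (fun k => (x0 + k%:R * u) ^+ n)) => //.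
  by rewrite oddX hodd orbT.
  move=> i k; apply: le_trans (normp_exprB n (x1 _) (x1 _)) _.
  rewrite natrD natrM natrX.
  rewrite (_ : _ - _ = p%:R ^+ r * (i%:R * u)); last by ring.
  rewrite normpM normpX normp_p ler_piMr ?exprn_ge0//.
  by rewrite normpM mulr_ile1 ?normp_ge0 ?normp_nat_le1.
have /boolp.choice[M MS] := fun n => cauchy_geom q01 (SS n).
exists M => n; split; last exact: MS.
have [r /(_ r (leqnn r)) hr] := exp_small q01 (exprn_gt0 n rho0).
by rewrite -(subrK (S n r) (M n)) normpD_le// ltW// (le_lt_trans (MS n r)).
Qed.

(** * Binomial series as power series in the exponent *)

Section Expansion.
Variables (rho : R).
Hypotheses (rho0 : 0 < rho) (rho_conv : rho * exp_rate < 1).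

Let theta01 : 0 <= rho * exp_rate < 1.
Proof. by rewrite mulr_ge0// ltW// exp_rate_gt0. Qed.

Let rho_le1 : 0 < rho <= 1.
Proof.
rewrite rho0/=; apply: le_trans (ltW rho_conv).
by rewrite ler_peMr ?exp_rate_ge1// ltW.
Qed.

Lemma normp_gbinomM y n z : normp y <= 1 -> normp z <= rho ^+ n ->
  normp (gbinom y n * z) <= (rho * exp_rate) ^+ n.
Proof.
move=> y1 zr; rewrite normpM exprMn mulrC.
by rewrite ler_pM ?normp_ge0// normp_gbinom.
Qed.

(** Exchange of the limit in [r] with the sum over [n]. Beyond a fixed [N] the
    terms are small uniformly in [r]; for the finitely many others, the growth
    [exp_rate ^+ N] of the binomials is beaten by the convergence of the
    moments. *)
Lemma int_gbinom_series (F : C -> C) (y : C) (M : nat -> C) (x : nat -> C) :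
  normp y <= 1 ->
  (forall k, F k%:R = series_sum (fun n => gbinom y n * x k ^+ n)) ->
  (forall k, normp (x k) <= rho) -> (forall n, normp (M n) <= rho ^+ n) ->
  (forall n r, normp (M n - \sum_(0 <= k < p ^ r) x k ^+ n * (-1) ^+ k)
                 <= p%:R^-1 ^+ r) ->
  int_mu_m1 F = series_sum (fun n => gbinom y n * M n).
Proof.
move=> y1 FE xr Mr MS; rewrite /int_mu_m1; apply: limitE.
apply/cvg_seq_normpP => e e0.
have [N /(_ N (leqnn N)) hN] := exp_small theta01 e0.
have tN : 0 < exp_rate ^+ N by rewrite exprn_gt0// exp_rate_gt0.
have q01 : 0 <= (p%:R^-1 : R) < 1.
  by rewrite invr_ge0 ler0n invf_lt1 ?p_gt0R ?p_gt1R.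
have [r0 hr0] := exp_small q01 (divr_gt0 e0 tN).
exists r0 => r /hr0; rewrite ltr_pdivlMr// => hr.
set A := series_sum _; pose A' := \sum_(0 <= n < N) gbinom y n * M n.
pose S n := \sum_(0 <= k < p ^ r) x k ^+ n * (-1) ^+ k.
pose B' := \sum_(0 <= n < N) gbinom y n * S n.
apply: (@normp_trans_lt A').
  apply: le_lt_trans hN; apply: (series_sum_geom theta01) => n.
  exact: normp_gbinomM.
apply: (@normp_trans_lt B').
  rewrite /A' /B' -sumrB big_nat_cond; apply: normp_sum_lt => // n.
  rewrite andbT => /andP[_ nN]; rewrite -mulrBr normpM.
  apply: le_lt_trans hr; rewrite mulrC ler_pM ?normp_ge0 ?MS//.
  apply: le_trans (normp_gbinom n y1) _.
  by rewrite ler_weXn2l ?exp_rate_ge1// ltnW.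
rewrite (_ : B' = \sum_(0 <= k < p ^ r)
   (\sum_(0 <= n < N) gbinom y n * x k ^+ n) * (-1) ^+ k); last first.
  rewrite /B' /S; under eq_bigr do rewrite mulr_sumr.
  rewrite exchange_big_nat /=; apply: eq_bigr => k _.
  by rewrite mulr_suml; apply: eq_bigr => n _; rewrite mulrA.
rewrite -sumrB; apply: normp_sum_lt => // k _.
rewrite -mulrBl normpM normpX normpN normp1 expr1n mulr1 normpBC FE.
apply: le_lt_trans hN; apply: (series_sum_geom theta01) => n.
by apply: normp_gbinomM => //; rewrite normpX lerXn2r ?nnegrE ?normp_ge0// ltW.
Qed.

Definition gbinom_poly (s : C) (n : nat) : {poly C} :=
  (n`!%:R)^-1 *: \prod_(i < n) ((1 - s - i%:R)%:P - 'X).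

Lemma gbinom_polyE s h n : (gbinom_poly s n).[h] = gbinom (1 - (s + h)) n.
Proof.
rewrite /gbinom_poly /gbinom hornerZ mulrC horner_prod; congr (_ * _).
by apply: eq_bigr => i _; rewrite !hornerE; ring.
Qed.

(** Thus only the terms with [n >= m] contribute to the coefficient of [h ^ m],
    which therefore decays. *)
Lemma size_gbinom_poly s n : (size (gbinom_poly s n) <= n.+1)%N.
Proof.
apply: leq_trans (size_scale_leq _ _) _.
rewrite -[in leqRHS](card_ord n) -sum1_card; elim/big_ind2: _ => //.
- by rewrite size_poly1.
- move=> m1 q1 m2 q2 h1 h2; apply: leq_trans (size_polyMleq _ _) _.
  rewrite -subn1 leq_subLR; apply: leq_trans (leq_add h1 h2) _.
  by rewrite addSn addnS.
- by move=> i _; rewrite -opprB size_polyN size_XsubC.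
Qed.

Lemma coef_prod_le1 (I : Type) (r : seq I) (P : I -> {poly C}) :
  (forall i j, normp (P i)`_j <= 1) ->
  forall j, normp (\prod_(i <- r) P i)`_j <= 1.
Proof.
move=> P1; elim/big_ind: _ => //.
- by move=> j; rewrite coef1; case: eqP => _; rewrite ?normp0 ?normp1.
- move=> q1 q2 h1 h2 j; rewrite coefM; apply: normp_sum_le => // i _.
  by rewrite normpM mulr_ile1 ?normp_ge0.
Qed.

Lemma coef_gbinom_poly s n j : normp s <= 1 ->
  normp (gbinom_poly s n)`_j <= exp_rate ^+ n.
Proof.
move=> s1; rewrite coefZ normpM -[leRHS]mulr1.
rewrite ler_pM ?normp_ge0 ?normp_fact_inv//.
apply: coef_prod_le1 => i k; rewrite coefB coefC coefX.
apply: normpB_le; case: eqP => _; rewrite ?normp0 ?normp1//.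
by rewrite normpB_le ?normp_nat_le1// normpB_le ?normp1.
Qed.

(** The double family of the [(gbinom_poly s n)`_m * d n] is bounded by a
    geometric sequence in [n] and vanishes for [m > n]; cutting both indices at
    the same [N] gives two finite sums that agree up to this bound. *)
Lemma gbinom_series_power_series (f : C -> C) (s : C) (d : nat -> C) :
  normp s <= 1 -> (forall n, normp (d n) <= rho ^+ n) ->
  (forall h, normp h <= 1 ->
     f (s + h) = series_sum (fun n => gbinom (1 - (s + h)) n * d n)) ->
  exists c, (forall m, normp (c m) <= (rho * exp_rate) ^+ m) /\
    power_series_at f s c (rho * exp_rate).
Proof.
move=> s1 dr fE.
have bd m n : normp ((gbinom_poly s n)`_m * d n) <= (rho * exp_rate) ^+ n.
  rewrite normpM exprMn mulrC ler_pM ?normp_ge0//; exact: coef_gbinom_poly.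
pose c m := series_sum (fun n => (gbinom_poly s n)`_m * d n).
have cE m N : normp (c m - \sum_(0 <= n < N) (gbinom_poly s n)`_m * d n)
    <= (rho * exp_rate) ^+ N by exact: (series_sum_geom theta01 (bd m)).
exists c; split=> [m|h h1 N].
  have := cE m m; rewrite big_nat_cond big1 ?subr0// => n /andP[/andP[_ nm] _].
  by rewrite nth_default ?mul0r// (leq_trans (size_gbinom_poly s n)).
have y1 : normp (1 - (s + h)) <= 1 by rewrite normpB_le ?normp1// normpD_le.
apply: (@normp_trans_le (\sum_(0 <= n < N) gbinom (1 - (s + h)) n * d n)).
  rewrite fE//; apply: (series_sum_geom theta01) => n; exact: normp_gbinomM.
rewrite normpBC (_ : \sum_(0 <= n < N) _ =
    \sum_(m < N) (\sum_(0 <= n < N) (gbinom_poly s n)`_m * d n) * h ^+ m).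
  rewrite -sumrB; apply: normp_sum_le => [|m _].
    by rewrite exprn_ge0//; case/andP: theta01.
  rewrite -mulrBl normpM; apply: le_trans (cE m N).
  by rewrite ler_piMr ?normp_ge0// normpX exprn_ile1 ?normp_ge0.
under [RHS]eq_bigr do rewrite mulr_suml.
rewrite exchange_big /= big_nat_cond [RHS]big_nat_cond; apply: eq_bigr => n.
rewrite andbT => /andP[_ nN].
rewrite -gbinom_polyE (@horner_coef_wide _ N); last first.
  exact: leq_trans (size_gbinom_poly s n) nN.
by rewrite mulr_suml; apply: eq_bigr => m _; rewrite mulrAC.
Qed.

End Expansion.

(** * Valuations of rational numbers *)

Lemma normp_le_vp x y : x != 0 -> y != 0 -> (normp x <= normp y) = (vp y <= vp x).
Proof.
move=> x0 y0; by rewrite !normpE// ler_p_powR lerN2 ler_rat.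
Qed.

Lemma normp_lt1_vp x : x != 0 -> (normp x < 1) = (0 < vp x).
Proof.
move=> x0; rewrite normpE// -[ltRHS](powRr0 (p%:R : R)) ltr_p_powR.
by rewrite oppr_lt0 ltr0q.
Qed.

Lemma normp_inj_vp x y : x != 0 -> y != 0 -> normp x = normp y -> vp x = vp y.
Proof.
by move=> x0 y0 xy; apply/eqP; rewrite eq_le -!normp_le_vp// xy lexx.
Qed.

Lemma vp1 : vp (1 : C) = 0.
Proof.
have := vpM (1 : C) 1 (oner_neq0 _) (oner_neq0 _).
by rewrite mulr1 => /eqP; rewrite -subr_eq0 opprD addNKr oppr_eq0 => /eqP.
Qed.

Lemma vpX x n : x != 0 -> vp (x ^+ n) = vp x *+ n.
Proof.
move=> x0; elim: n => [|n IH]; first by rewrite expr0 vp1.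
by rewrite exprS vpM ?expf_neq0// IH mulrS.
Qed.

Lemma vpV x : x != 0 -> vp x^-1 = - vp x.
Proof.
move=> x0; apply/eqP; rewrite -addr_eq0 addrC -vpM ?invr_eq0//.
by rewrite divff// vp1.
Qed.

Lemma vpN x : x != 0 -> vp (- x) = vp x.
Proof. by move=> x0; apply: normp_inj_vp; rewrite ?oppr_eq0 ?normpN. Qed.

Lemma vpXz x (n : int) : x != 0 -> vp (x ^ n) = vp x *~ n.
Proof.
by case: n => n x0; rewrite ?NegzE ?exprnN ?vpV ?expf_neq0// vpX// ?mulrNz.
Qed.

Lemma vp_nat n : (0 < n)%N -> vp (n%:R : C) = (logn p n)%:R.
Proof.
move=> n0; rewrite -[RHS](mulr_natl 1) mulr1 -vp_p -vpX ?p_neq0//.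
apply: normp_inj_vp; rewrite ?natr_neq0// ?expf_neq0 ?p_neq0//.
by rewrite normp_nat// normpX normp_p.
Qed.

Lemma int_natE (z : int) : (z%:~R : C) = (-1) ^+ (z < 0)%R * (`|z|%N)%:R.
Proof. by rewrite {1}[z]intEsign rmorphM rmorph_sign. Qed.

Lemma vp_int (z : int) : z != 0 -> vp (z%:~R : C) \is a Num.int.
Proof.
move=> z0; have z0' : (0 < `|z|)%N by rewrite absz_gt0.
rewrite int_natE; case: (z < 0)%R; rewrite ?expr1 ?mulN1r ?expr0 ?mul1r.
  by rewrite vpN ?natr_neq0// vp_nat// natr_int.
by rewrite vp_nat// natr_int.
Qed.

Lemma intr_neq0 (z : int) : z != 0 -> (z%:~R : C) != 0.
Proof.
by move=> z0; rewrite int_natE mulf_neq0 ?signr_eq0// natr_neq0// absz_gt0.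
Qed.

Lemma vp_ratr (q : rat) : q != 0 -> vp (ratr q : C) \is a Num.int.
Proof.
move=> q0; have n0 : numq q != 0 by rewrite numq_eq0.
rewrite /ratr vpM ?invr_eq0 ?intr_neq0 ?denq_neq0// vpV ?intr_neq0 ?denq_neq0//.
by rewrite rpredB// vp_int// denq_neq0.
Qed.

Lemma padic_rat_approx x (e : R) : padic_rat x -> 0 < e ->
  exists q : rat, normp (x - ratr q) < e.
Proof.
move=> xQ e0; have [|y [[q _ <-] /= h]] := xQ [set y | normp (x - y) < e].
  by apply/nbhs_normpP; exists e.
by exists q.
Qed.

Lemma ratr_padic_rat (q : rat) : padic_rat (ratr q : C).
Proof. by apply: subset_closure; exists q. Qed.

(** The valuation is locally constant away from 0, hence it takes on the
    closure of the rationals the same values as on the rationals. *)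
Lemma vp_padic_rat x : padic_rat x -> x != 0 -> vp x \is a Num.int.
Proof.
move=> xQ x0; have [q qx] := padic_rat_approx xQ (normp_gt0 x0).
have nq : normp (ratr q : C) = normp x.
  by apply: normp_isosceles; rewrite normpBC.
have rq0 : (ratr q : C) != 0 by rewrite -normp_eq0 nq normp_eq0.
have q0 : q != 0 by apply: contraNneq rq0 => ->; rewrite /ratr mul0r.
by rewrite -(normp_inj_vp rq0 x0 nq) vp_ratr.
Qed.

(** After cancelling the powers of [p], the denominator is prime to [p], and its
    inverse modulo [p] can be represented by a natural number. *)
Lemma natr_quotient_residue m n : (0 < n)%N ->
  normp (m%:R : C) <= normp (n%:R : C) ->
  exists k : nat, normp (m%:R / n%:R - k%:R : C) < 1.
Proof.
move=> n0; case: (posnP m) => [->|m0] mn.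
  by exists 0%N; rewrite mul0r subrr normp0 ltr01.
have pvn : (logn p n <= logn p m)%N.
  by move: mn; rewrite normp_le_vp ?natr_neq0// !vp_nat// ler_nat.
have [m' _ mE] := pfactor_coprime hp m0.
have [n' pn' nE] := pfactor_coprime hp n0.
have n'0 : (0 < n')%N by case: (n') pn' => //; rewrite prime_coprime// dvdn0.
have [t r tr _] := egcdnP p n'0; rewrite gcdnC (eqP pn') in tr.
have n'1 : normp (n'%:R : C) = 1 by rewrite normp_ndvdn// -prime_coprime.
exists (m' * p ^ (logn p m - logn p n) * t)%N.
rewrite {1}mE {1}nE -{1}(subnK pvn) expnD !natrM.
have cancel (A B D P c : C) : B != 0 -> P != 0 ->
    A * (D * P) / (B * P) - A * D * c = - (A * D / B * (c * B - 1)).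
  by move=> B0 P0; field; rewrite B0 P0.
have pX0 : ((p ^ logn p n)%:R : C) != 0 by rewrite natr_neq0// expn_gt0 prime_gt0.
rewrite cancel ?natr_neq0//.
rewrite -!natrM.
rewrite tr natrD addrK normpN !normpM normpV n'1 invr1 mulr1.
apply: le_lt_trans (normp_dvdn (dvdn_mull r (dvdnn p))).
by rewrite ler_piMl ?normp_ge0 ?normp_nat_le1.
Qed.

Lemma ratr_quotient_residue (q1 q2 : rat) : (ratr q2 : C) != 0 ->
  normp (ratr q1 : C) <= normp (ratr q2 : C) ->
  exists k : nat, normp (ratr q1 / ratr q2 - k%:R : C) < 1.
Proof.
move=> q20 q12; have nq2 : numq q2 != 0.
  by apply: contraNneq q20 => h; rewrite /ratr h mul0r.
have d1 := denq_neq0 q1; have d2 := denq_neq0 q2.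
pose m := (`|numq q1| * `|denq q2|)%N; pose n := (`|numq q2| * `|denq q1|)%N.
pose sg : C := (-1) ^+ (numq q1 < 0)%R * (-1) ^+ (numq q2 < 0)%R.
have quotE : (ratr q1 / ratr q2 : C) = sg * (m%:R / n%:R).
  rewrite /ratr /sg /m /n !natrM !int_natE !ltNge !denq_ge0 /= !expr0 !mul1r.
  have inv_sg (b : bool) : ((-1 : C) ^+ b)^-1 = (-1) ^+ b by case: b; rewrite ?invrN1 ?invr1.
  rewrite !invfM invrK inv_sg; ring.
have n0 : (0 < n)%N by rewrite muln_gt0 !absz_gt0 nq2.
have sg1 : normp sg = 1 by rewrite normpM !normpX normpN normp1 !expr1n mulr1.
have [|k mnk] := @natr_quotient_residue m n n0.
  have n0R : 0 < normp (n%:R : C) by rewrite normp_gt0// natr_neq0.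
  rewrite -[leRHS]mul1r -ler_pdivrMr// -normpV -normpM.
  rewrite -[X in X <= _]mul1r -{1}sg1 -normpM -quotE normpM normpV.
  by rewrite ler_pdivrMr ?mul1r// normp_gt0.
have [s1|s1] : sg = 1 \/ sg = -1.
  rewrite /sg; do 2 case: (_ < _)%R; rewrite ?expr1 ?expr0 ?mulrNN ?mulr1 ?mul1r; by [left|right].
  by exists k; rewrite quotE s1 mul1r.
(* The sign is absorbed in the factor [p - 1], which is -1 modulo [p]. *)
exists (k * p.-1)%N; rewrite quotE s1 natrM -subn1 natrB ?prime_gt0//.
have -> : -1 * (m%:R / n%:R) - k%:R * (p%:R - 1) = - (m%:R / n%:R - k%:R) - k%:R * p%:R :> C.
  by ring.
by rewrite normpB_lt ?normpN// -natrM normp_dvdn ?dvdn_mull.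
Qed.

(** * Residues and roots of unity *)

(** This is the injectivity of Frobenius on residues: [y ^+ p - 1] is congruent
    to [(y - 1) ^+ p] modulo [p]. *)
Lemma normp_sub1_expr_p y : normp y <= 1 -> normp (y ^+ p - 1) < 1 ->
  normp (y - 1) < 1.
Proof.
move=> y1; have w1 : normp (y - 1) <= 1 by rewrite normpB_le ?normp1.
rewrite -{1}(subrK 1 y) [_ + 1]addrC; move: (y - 1) w1 => w w1.
rewrite exprDn -(big_mkord xpredT (fun i => 1 ^+ (p - i) * w ^+ i *+ 'C(p, i))).
rewrite big_nat_recr//= big_ltn ?prime_gt0// subn0 expr1n expr0 mulr1 bin0 mulr1n.
rewrite binn subnn expr0 mul1r mulr1n; set S := \sum_(_ <= _ < _) _.
rewrite (_ : _ - 1 = S + w ^+ p); last by ring.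
move=> h.
have S1 : normp S < 1.
  rewrite /S big_nat_cond; apply: normp_sum_lt => // i; rewrite andbT => ip.
  rewrite expr1n mul1r -mulr_natl normpM.
  apply: le_lt_trans (normp_dvdn (prime_dvd_bin hp ip)).
  by rewrite ler_piMr ?normp_ge0// normpX exprn_ile1 ?normp_ge0.
have : normp (w ^+ p) < 1 by rewrite -(addKr S (w ^+ p)) addrC normpB_lt.
rewrite normpX; apply: contraTlt => w1'; rewrite -leNgt.
exact: exprn_ege1.
Qed.

(** The [p]-part of the exponent can be dropped. *)
Lemma normp_sub1_expr_natl y n : (0 < n)%N -> normp y <= 1 ->
  normp (y ^+ n - 1) < 1 ->
  exists m, [/\ (0 < m)%N, coprime m p & normp (y ^+ m - 1) < 1].
Proof.
move=> n0 y1; have [m pm nE] := pfactor_coprime hp n0.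
have m0 : (0 < m)%N by case: m pm {nE} => //; rewrite prime_coprime// dvdn0.
rewrite nE; elim: (logn p n) => [|k IH]; last first.
  rewrite expnSr mulnA exprM => /normp_sub1_expr_p h; apply/IH/h.
  by rewrite normpX exprn_ile1 ?normp_ge0.
by rewrite expn0 muln1 => h; exists m; split; rewrite // coprime_sym.
Qed.

Lemma open_unit_ball x : open [set y : C | normp (x - y) < 1].
Proof.
rewrite openE => y /= xy; apply/nbhs_normpP; exists 1 => // z yz.
exact: normp_trans_lt xy yz.
Qed.

(** The residue of [u] is algebraic over the prime field: [u] is a unit close
    to an element algebraic over the [p]-adic rationals, whose equation,
    divided by a coefficient of maximal norm, has a nonzero reduction. *)
Lemma residue_algebraic u : normp u = 1 ->
  exists (n : nat -> nat) (N i0 : nat), [/\ (i0 < N)%N, ~~ (p %| n i0)%N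
    & normp (\sum_(0 <= i < N) (n i)%:R * u ^+ i) < 1].
Proof.
move=> u1.
have [|x [/= ux [q [q0 qQ qx]]]] := @dense_algebraic R p C _ _ (@open_unit_ball u).
  by exists u => /=; rewrite subrr normp0 ltr01.
have x1 : normp x = 1 by rewrite -u1; apply: normp_isosceles; rewrite u1 normpBC.
have sq : (0 < size q)%N by rewrite size_poly_gt0.
have [i0 _ i0max] := @arg_maxP _ R 'I_(size q) (Ordinal sq) xpredT
  (fun i => normp q`_i) isT.
set M := normp q`_i0 in i0max.
have M0 : 0 < M.
  have lq : ((size q).-1 < size q)%N by rewrite prednK.
  apply: lt_le_trans (i0max (Ordinal lq) isT).
  by rewrite normp_gt0// -lead_coefE lead_coef_eq0.
have qM i : normp q`_i <= M.
  have [iq|iq] := ltnP i (size q); first exact: (i0max (Ordinal iq) isT).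
  by rewrite nth_default// normp0 ltW.
have /boolp.choice[a qa] := fun i => padic_rat_approx (qQ i) M0.
set b : C := ratr (a i0).
have bM : normp b = M by apply: normp_isosceles; rewrite normpBC; exact: qa.
have b0 : b != 0 by rewrite -normp_eq0 bM gt_eqF.
have aM i : normp (ratr (a i) : C) <= normp b.
  by rewrite bM -[ratr _](subKr q`_i) normpB_le// ltW.
have /boolp.choice[n nab] := fun i => ratr_quotient_residue b0 (aM i).
exists n, (size q), i0; split => //.
  apply/negP => /normp_dvdn pn; have := nab i0.
  rewrite divff// => h; have := normpD_lt h pn.
  by rewrite subrK normp1 ltxx.
have x_le1 k : normp (x ^+ k) <= 1 by rewrite normpX x1 expr1n.
(* Subtracting [q.[x] / b], which is 0, makes every summand small. *)
have xE : \sum_(0 <= i < size q) (n i)%:R * u ^+ i =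
    \sum_(0 <= i < size q) ((n i)%:R * (u ^+ i - x ^+ i)
      - (ratr (a i) / b - (n i)%:R) * x ^+ i - (q`_i - ratr (a i)) * x ^+ i / b).
  have qx0 : \sum_(0 <= i < size q) q`_i * x ^+ i / b = 0.
    by rewrite -mulr_suml big_mkord -horner_coef (eqP qx) mul0r.
  transitivity (\sum_(0 <= i < size q) ((n i)%:R * u ^+ i - q`_i * x ^+ i / b)).
    by rewrite sumrB qx0 subr0.
  by apply: eq_bigr => i _; ring.
rewrite xE; apply: normp_sum_lt => // i _; apply: normpB_lt.
  apply: normpB_lt.
    rewrite normpM; apply: le_lt_trans ux; rewrite normpBC.
    apply: le_trans (_ : normp (u ^+ i - x ^+ i) <= _).
      by rewrite ler_piMl ?normp_ge0 ?normp_nat_le1// normpBC.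
    by rewrite -[leRHS]normpBC; apply: normp_exprB; rewrite ?u1 ?x1.
  by rewrite normpM; apply: le_lt_trans (nab i); rewrite ler_piMr ?normp_ge0.
rewrite !normpM normpV bM ltr_pdivrMr// mul1r.
by apply: le_lt_trans (qa i); rewrite ler_piMr ?normp_ge0.
Qed.

(** The last coefficient [n d] prime to [p] can be inverted modulo [p], and the
    relation then expresses [u ^+ d], hence all the powers of [u], by the
    powers below [d] modulo the maximal ideal. *)
Lemma powers_residue_finite u (n : nat -> nat) (N i0 : nat) : normp u = 1 ->
  (i0 < N)%N -> ~~ (p %| n i0)%N ->
  normp (\sum_(0 <= i < N) (n i)%:R * u ^+ i) < 1 ->
  exists d, forall j, exists c : nat -> nat,
    normp (u ^+ j - \sum_(0 <= i < d) (c i)%:R * u ^+ i) < 1.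
Proof.
move=> u1 i0N ni0 nu.
have u_le1 k : normp (u ^+ k) <= 1 by rewrite normpX u1 expr1n.
have small (m : nat) z : normp z < 1 -> normp (m%:R * z) < 1.
  move=> z1; rewrite normpM; apply: le_lt_trans z1.
  by rewrite ler_piMl ?normp_ge0 ?normp_nat_le1.
have smallu m k : (p %| m)%N -> normp (m%:R * u ^+ k) < 1.
  move=> pm; rewrite normpM; apply: le_lt_trans (normp_dvdn pm).
  by rewrite ler_piMr ?normp_ge0.
case: (@arg_maxnP _ (Ordinal i0N) (fun i => ~~ (p %| n (i : 'I_N))%N)
  (fun i => i : nat)) => // -[d dN] /= nd dmax.
exists d; pose span z := exists c : nat -> nat,
  normp (z - \sum_(0 <= i < d) (c i)%:R * u ^+ i) < 1.
have span0 : span 0.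
  by exists (fun=> 0%N); rewrite big1 ?subr0 ?normp0// => i _; rewrite mul0r.
have spanD y z : span y -> span z -> span (y + z).
  move=> [c yc] [c' zc']; exists (fun i => c i + c' i)%N.
  under eq_bigr do rewrite natrD mulrDl.
  by rewrite big_split /= opprD addrACA normpD_lt.
have spanM (m : nat) z : span z -> span (m%:R * z).
  move=> [c zc]; exists (fun i => m * c i)%N.
  under eq_bigr do rewrite natrM -mulrA.
  by rewrite -mulr_sumr -mulrBr small.
have span_near y z : normp (y - z) < 1 -> span z -> span y.
  by move=> yz [c zc]; exists c; apply: normp_trans_lt yz zc.
have span_low i : (i < d)%N -> span (u ^+ i).
  move=> id; exists (fun j => j == i : nat).
  rewrite (bigD1_seq i) ?mem_index_iota ?iota_uniq//= eqxx mul1r big1 ?addr0.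
    by rewrite subrr normp0.
  by move=> j /negbTE ->; rewrite mul0r.
have span_d : span (u ^+ d).
  have nd0 : (0 < n d)%N by case: (n d) nd => //; rewrite dvdn0.
  have [t r tr _] := egcdnP p nd0.
  have cpn : coprime p (n d) by rewrite prime_coprime.
  rewrite gcdnC (eqP cpn) in tr.
  exists (fun i => p.-1 * t * n i)%N.
  move: nu; rewrite (big_cat_nat (n := d))//=; last exact: ltnW.
  rewrite (big_ltn dN).
  set A := \sum_(0 <= i < d) _; set B := \sum_(d.+1 <= i < N) _ => nu.
  have -> : \sum_(0 <= i < d) (p.-1 * t * n i)%:R * u ^+ i = (p%:R - 1) * (t%:R * A).
    rewrite /A !mulr_sumr; apply: eq_bigr => i _.
    by rewrite -subn1 !natrM natrB ?prime_gt0//; ring.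
  (* Modulo [p] the coefficient [t * n d] is 1 and [p - 1] is -1. *)
have -> : u ^+ d - (p%:R - 1) * (t%:R * A)
     = t%:R * (A + ((n d)%:R * u ^+ d + B)) - r%:R * (p%:R * u ^+ d)
       - t%:R * (B + p%:R * A).
    have := congr1 (fun k => k%:R : C) tr; rewrite natrD !natrM => trC.
    have -> : u ^+ d = (t%:R * (n d)%:R - r%:R * p%:R) * u ^+ d.
      by rewrite trC addrAC subrr add0r mul1r.
    ring: trC.
  apply: normpB_lt; first apply: normpB_lt; apply: small => //.
    exact: smallu.
  apply: normpD_lt.
    rewrite /B big_nat_cond; apply: normp_sum_lt => // i /andP[/andP[di iN] _].
    apply: smallu; apply: contraLR di => pi; rewrite -leqNgt.
    exact: (dmax (Ordinal iN)).
  rewrite normpM; apply: le_lt_trans normp_p_lt1.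
  rewrite ler_piMr ?normp_ge0//; apply: normp_sum_le => // i _.
  by rewrite normpM mulr_ile1 ?normp_ge0 ?normp_nat_le1.
have span_1 : span (u ^+ 0).
  by have [d0|/span_low//] := posnP d; rewrite -[X in u ^+ X]d0.
elim=> [//|j [c jc]].
apply: (@span_near _ ((\sum_(0 <= i < d) (c i)%:R * u ^+ i) * u)).
  by rewrite exprSr -mulrBl normpM u1 mulr1.
rewrite mulr_suml big_nat_cond; elim/big_ind: _ => // i /andP[/andP[_ id] _].
rewrite -mulrA -exprSr; apply: spanM.
by move: id; rewrite leq_eqVlt => /predU1P[->|/span_low].
Qed.

(** Reducing the coefficients modulo [p] in [powers_residue_finite] leaves
    finitely many residues for infinitely many powers of [u]. *)
Lemma residue_root_of_unity u : normp u = 1 ->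
  exists n, [/\ (0 < n)%N, coprime n p & normp (u ^+ n - 1) < 1].
Proof.
move=> u1; have [n [N [i0 [i0N ni0 nu]]]] := residue_algebraic u1.
have [d /boolp.choice[c uc]] := powers_residue_finite u1 i0N ni0 nu.
have u_le1 k : normp (u ^+ k) <= 1 by rewrite normpX u1 expr1n.
pose T := {ffun 'I_d -> 'I_p}.
pose F (j : 'I_#|T|.+1) : T :=
  [ffun i : 'I_d => Ordinal (ltn_pmod (c j i) (prime_gt0 hp))].
have /injectivePn[j1 [j2 j12 Fj]] : ~~ injectiveb F.
  by apply/negP => /injectiveP/leq_card; rewrite card_ord ltnn.
have cj i : (i < d)%N -> c j1 i = c j2 i %[mod p].
  move=> id; have := congr1 (fun f : T => f (Ordinal id)) Fj.
  by rewrite !ffunE => /(congr1 (@nat_of_ord p)).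
have uj : normp (u ^+ j1 - u ^+ j2) < 1.
  apply: normp_trans_lt (uc j1) _.
  apply: (@normp_trans_lt (\sum_(0 <= i < d) (c j2 i)%:R * u ^+ i)); last first.
    by rewrite normpBC; exact: uc.
  rewrite -sumrB big_nat_cond; apply: normp_sum_lt => // i /andP[/andP[_ id] _].
  rewrite -mulrBl normpM; apply: le_lt_trans (_ : normp ((c j1 i)%:R - (c j2 i)%:R : C) < 1).
    by rewrite ler_piMr ?normp_ge0.
  rewrite (divn_eq (c j1 i) p) (divn_eq (c j2 i) p) (cj i id) !natrD opprD addrACA subrr addr0.
  by rewrite normpB_lt// normp_dvdn// dvdn_mull.
have wl (i j : nat) : (i < j)%N -> normp (u ^+ i - u ^+ j) < 1 ->
    normp (u ^+ (j - i) - 1) < 1.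
  move=> ij; rewrite -{1}(subnK (ltnW ij)) exprD -[X in X - _]mul1r -mulrBl normpM.
  by rewrite [normp (u ^+ i)]normpX u1 expr1n mulr1 normpBC.
have [j1j2|j2j1] : (j1 < j2)%N \/ (j2 < j1)%N by apply/orP; rewrite -neq_ltn.
  by apply: (@normp_sub1_expr_natl _ (j2 - j1)); rewrite ?subn_gt0 ?u1//; exact: wl.
apply: (@normp_sub1_expr_natl _ (j1 - j2)); rewrite ?subn_gt0 ?u1//.
by apply: wl => //; rewrite normpBC.
Qed.

(** The value of ['X^n - 1] at [u] is the product of the distances to the
    [n]th roots of unity; it is smaller than 1, so one of the factors is. *)
Lemma unity_prime_to_p_near u : normp u = 1 ->
  exists2 z, unity_prime_to_p z & normp (u - z) < 1.
Proof.
move=> u1; have [n [n0 np un]] := residue_root_of_unity u1.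
have [r rE] := closed_field_poly_normal ('X^n - 1%:P : {poly C}).
rewrite lead_coefDl ?size_polyXn ?size_polyN ?size_polyC ?oner_neq0 ?ltnS// in rE.
rewrite lead_coefXn scale1r in rE.
have /hasP[z zr uz] : has (fun z => normp (u - z) < 1) r.
  apply: contraLR un => /hasPn rn; rewrite -leNgt.
  have -> : u ^+ n - 1 = ('X^n - 1%:P : {poly C}).[u] by rewrite !hornerE.
  rewrite rE horner_prod normp_prod big_seq; elim/big_ind: _ => //.
    by move=> *; rewrite mulr_ege1.
  by move=> z /rn; rewrite -leNgt hornerXsubC.
have zn : z ^+ n = 1.
  apply/eqP; rewrite -subr_eq0.
  have -> : z ^+ n - 1 = ('X^n - 1%:P : {poly C}).[z] by rewrite !hornerE.
  by rewrite rE -/(root _ z) root_prod_XsubC.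
have [m mz mn] := prim_order_exists n0 zn.
by exists z => //; exists m => //; apply: coprime_dvdl np.
Qed.

(** * The projections of an element *)

Section Projection.
Variable iota : {rmorphism algC -> C}.

Lemma ppow_denq r : ppow iota r ^+ `|denq r| = p%:R ^ numq r.
Proof.
have d0 : (0 < `|denq r|)%N by rewrite absz_gt0 denq_neq0.
rewrite /ppow -rmorphXn exprnP -exprzAC -exprnP rootCK// fmorphXz.
by rewrite rmorph_nat.
Qed.

Lemma ppow_neq0 r : ppow iota r != 0.
Proof.
have d0 : (0 < `|denq r|)%N by rewrite absz_gt0 denq_neq0.
have : ppow iota r ^+ `|denq r| != 0 by rewrite ppow_denq expfz_neq0 ?p_neq0.
by rewrite expf_eq0 d0.
Qed.

(** A power of [ppow iota r] is an integral power of [p], and the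
    value group is torsion free. *)
Lemma vp_ppow r : vp (ppow iota r) = r.
Proof.
have := congr1 vp (ppow_denq r).
rewrite vpX ?ppow_neq0// vpXz ?p_neq0// vp_p -[LHS]mulr_natr => h.
have dE : (`|denq r|%N)%:R = (denq r)%:~R :> rat.
  by rewrite pmulrn gez0_abs// denq_ge0.
by rewrite -[RHS]divq_num_den -h dE mulfK// intr_eq0 denq_neq0.
Qed.

Lemma normp_div_ppow x : x != 0 -> normp (x / ppow iota (vp x)) = 1.
Proof.
move=> x0; rewrite normpM normpV normpE// normpE ?ppow_neq0// vp_ppow.
by rewrite divff// gt_eqF// powR_gt0// p_gt0R.
Qed.

(** This rules out the default value in the definition of [teich]. *)
Lemma teich_near x : x != 0 -> unity_prime_to_p (teich iota x) /\
  normp (x / ppow iota (vp x) - teich iota x) < 1.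
Proof.
move=> /normp_div_ppow/unity_prime_to_p_near[z zu xz]; rewrite /teich.
by case: xgetP => [y _ []|/(_ z)/= []].
Qed.

Lemma normp_teich x : x != 0 -> normp (teich iota x) = 1.
Proof.
move=> x0; have [_ xt] := teich_near x0; have x1 := normp_div_ppow x0.
by rewrite -x1; apply: normp_isosceles; rewrite x1 normpBC.
Qed.

Lemma teich_neq0 x : x != 0 -> teich iota x != 0.
Proof. by move=> x0; rewrite -normp_eq0 normp_teich// oner_neq0. Qed.

Lemma normp_omegav x : x != 0 -> normp (omegav iota x) = normp x.
Proof.
move=> x0; rewrite normpM normp_teich// mulr1.
by rewrite !normpE ?ppow_neq0// vp_ppow.
Qed.

Lemma normp_ang_sub1 x : x != 0 -> normp (ang iota x - 1) < 1.
Proof.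
move=> x0; have [_ xt] := teich_near x0; have t0 := teich_neq0 x0.
have -> : ang iota x - 1 = (x / ppow iota (vp x) - teich iota x) / teich iota x.
  by rewrite /ang /omegav; field; rewrite t0 ppow_neq0.
by rewrite normpM normpV normp_teich// invr1 mulr1.
Qed.

(** Both factors of [omegav] are constant on the open ball of radius [normp x]
    around [x]. *)
Lemma omegav_eq_of_near x y : x != 0 -> normp (x - y) < normp x ->
  omegav iota y = omegav iota x.
Proof.
move=> x0 xy; have nxy : normp y = normp x.
  by apply: normp_isosceles; rewrite normpBC.
have y0 : y != 0 by rewrite -normp_eq0 nxy normp_eq0.
have vxy : vp y = vp x by apply: normp_inj_vp.
have xyp : normp (x / ppow iota (vp x) - y / ppow iota (vp x)) < 1.
  rewrite -mulrBl normpM normpV [normp (ppow _ _)]normpE ?ppow_neq0// vp_ppow.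
  by rewrite -normpE// ltr_pdivrMr ?mul1r// normp_gt0.
rewrite /omegav vxy; congr (_ * xget _ _); rewrite vxy.
apply/seteqP; split=> z /= [zu zy]; split=> //.
  exact: normp_trans_lt xyp zy.
by apply: normp_trans_lt zy; rewrite normpBC.
Qed.

Lemma ang_add_nat a k : 1 < normp a ->
  ang iota (a + k%:R) = 1 + ((ang iota a - 1) + k%:R * (omegav iota a)^-1).
Proof.
move=> a1; have a0 : a != 0 by rewrite -normp_eq0 gt_eqF// (lt_trans ltr01).
rewrite /ang (@omegav_eq_of_near a).
- by rewrite mulrDl; ring.
- exact: a0.
rewrite opprD addNKr normpN; apply: le_lt_trans a1; exact: normp_nat_le1.
Qed.

Lemma angpowE a y : angpow iota a y =
  series_sum (fun n => gbinom y n * (ang iota a - 1) ^+ n).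
Proof. by []. Qed.

End Projection.

(** * Ramification *)

Section Ramification.
Variables (K : set C) (e : nat).
Hypotheses (Kdiv : divring_closed [in K]) (QK : @padic_rat R p C `<=` K)
  (he : is_ramification_index K e).

Let K1 : K 1.
Proof. by case: Kdiv => /set_mem. Qed.

Let KB x y : K x -> K y -> K (x - y).
Proof. by case: Kdiv => _ h _ Kx Ky; apply/set_mem/h; apply/mem_set. Qed.

Let Kdivr x y : K x -> K y -> K (x / y).
Proof. by case: Kdiv => _ _ h Kx Ky; apply/set_mem/h; apply/mem_set. Qed.

Let KM x y : K x -> K y -> K (x * y).
Proof. by move=> Kx Ky; rewrite -[y]invrK -[y^-1]mul1r; apply/Kdivr/Kdivr. Qed.

Let KX x n : K x -> K (x ^+ n).
Proof. by move=> Kx; elim: n => [|n IH]; rewrite ?expr0// exprS; apply: KM. Qed.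

(** Among the [e + 1] cosets of [0], [vp x], ..., [e * vp x] two coincide. *)
Lemma ramification_multiple_int x : K x -> x != 0 ->
  exists2 m, (0 < m <= e)%N & vp x *+ m \is a Num.int.
Proof.
move=> Kx x0; pose Z : set rat := value_group (@padic_rat R p C).
have Z0 : Z 0.
  exists 1; last exact: vp1.
  by split; [rewrite -(_ : ratr 1 = 1) ?rmorph1; [exact: ratr_padic_rat|rewrite /ratr divr1]
            | exact: oner_neq0].
have Zint g : Z g -> g \is a Num.int.
  by move=> [y [yQ y0] <-]; exact: vp_padic_rat.
pose coset g : set rat := [set g + h | h in Z].
have /card_set_bijP[f [fe finj _]] := he.
have cosetK i : [set [set g + h | h in Z] | g in value_group K] (coset (vp x *+ i)).
  exists (vp x *+ i) => //; exists (x ^+ i); last exact: vpX.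
  by split; [exact: KX|rewrite /= expf_neq0].
pose F (i : 'I_e.+1) : 'I_e := Ordinal (fe _ (cosetK i)).
have /injectivePn[i [j ij Fij]] : ~~ injectiveb F.
  by apply/negP => /injectiveP/leq_card; rewrite !card_ord ltnn.
have cij : coset (vp x *+ i) = coset (vp x *+ j).
  by apply: finj; rewrite ?inE//; have := congr1 (@nat_of_ord e) Fij.
wlog ltij : i j ij Fij cij / (j < i)%N.
  move=> wl; have [lij|lji] : (i < j)%N \/ (j < i)%N by apply/orP; rewrite -neq_ltn.
    by apply: (wl j i); rewrite // eq_sym.
  exact: (wl i j).
exists (i - j)%N.
  by rewrite subn_gt0 ltij/= leq_subLR (leq_trans _ (leq_addl _ _))// -ltnS.
have : coset (vp x *+ j) (vp x *+ i) by rewrite -cij; exists 0; rewrite ?addr0.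
move=> [h Zh hE]; rewrite mulrnBr ?(ltnW ltij)// -hE addrAC subrr add0r.
exact: Zint.
Qed.

(** [vp x] has a multiple [m * vp x] in the integers with [m <= e], and its
    denominator divides [m]. *)
Lemma ramification_denq x : K x -> x != 0 -> (`|denq (vp x)| <= e)%N.
Proof.
move=> Kx x0; have [m /andP[m0 me] /intrP[z zE]] := ramification_multiple_int Kx x0.
move: (vp x) zE => g zE; apply: leq_trans me; apply: dvdn_leq => //.
rewrite -(@Gauss_dvdr _ `|numq g|); last by rewrite coprime_sym coprime_num_den.
apply/dvdnP; exists `|z|%N.
have : numq g * m%:Z = z * denq g.
  by apply: (@intr_inj rat); rewrite !intrM -zE numqE -mulr_natr mulrAC.
by move=> /(congr1 absz); rewrite !abszM.
Qed.

(** This is [p^(-1/e)], the largest norm below 1 that the elements of [K] can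
    have. *)
Definition ram_radius : R := p%:R `^ (- (e%:R^-1)).

Lemma ram_radius_gt0 : 0 < ram_radius.
Proof. by rewrite powR_gt0// p_gt0R. Qed.

Lemma ramification_gap x : K x -> normp x < 1 -> normp x <= ram_radius.
Proof.
move=> Kx; have [-> _|x0] := eqVneq x 0.
  by rewrite normp0 ltW// ram_radius_gt0.
have [m /andP[m0 me] mint] := ramification_multiple_int Kx x0.
rewrite normp_lt1_vp// normpE// ler_p_powR lerN2 => v0.
have m1 : 1 <= vp x *+ m.
  have : 0 < vp x *+ m by rewrite mulrn_wgt0.
  by case/intrP: mint => z ->; rewrite ltr0z ler1z gtz0_ge1.
have : (m%:R^-1 : R) <= ratr (vp x).
  rewrite -[leLHS]mul1r ler_pdivrMr ?ltr0n// mulr_natr.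
  by rewrite -(rmorph1 (@ratr R)) -rmorphMn ler_rat.
by apply: le_trans; rewrite lef_pV2 ?posrE ?ltr0n ?ler_nat// (leq_trans m0).
Qed.

Lemma ram_radius_exp_rate : (0 < e)%N -> (e < p.-1)%N -> ram_radius * exp_rate < 1.
Proof.
move=> e0 ep; have p0 : (p%:R : R) != 0 by rewrite gt_eqF// p_gt0R.
rewrite /ram_radius /exp_rate -powRD ?p0 ?implybT//.
rewrite -[ltRHS](powRr0 (p%:R : R)) ltr_p_powR addrC subr_lt0.
by rewrite ltf_pV2 ?posrE ?ltr0n ?ltr_nat// (leq_ltn_trans _ ep).
Qed.

(** A suitable power of [ang iota a], of exponent prime to [p], lies in [K];
    raising to such a power is an isometry around [1]. *)
Lemma normp_ang_sub1_ramified (iota : {rmorphism algC -> C}) a :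
  (e < p)%N -> K a -> a != 0 -> normp (ang iota a - 1) <= ram_radius.
Proof.
move=> ep Ka a0; have d_e := ramification_denq Ka a0.
have d0 : (0 < `|denq (vp a)|)%N by rewrite absz_gt0 denq_neq0.
have [[N Np tN] _] := teich_near iota a0.
set d := `|_|%N in d_e d0.
have dp : coprime d p.
  rewrite coprime_sym prime_coprime//; apply/negP => /(dvdn_leq d0).
  by rewrite leqNgt (leq_ltn_trans d_e ep).
have ang1 := normp_ang_sub1 iota a0.
have angN : normp (ang iota a) = 1.
  by rewrite -(normp1); apply: normp_isosceles; rewrite normp1.
have Kang : K (ang iota a ^+ (d * N)).
  rewrite /ang /omegav exprMn exprVn exprMn [ppow _ _ ^+ _]exprM [ppow _ _ ^+ d]ppow_denq.
  rewrite (mulnC d N) [teich _ _ ^+ _]exprM (prim_expr_order tN) expr1n mulr1.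
  apply: Kdivr; first exact: KX.
  have Kp : K p%:R.
    by apply: QK; rewrite (_ : p%:R = ratr p%:R)//; [exact: ratr_padic_rat|rewrite ratr_nat].
  apply: KX; case: (numq _) => n; first exact: KX.
  by rewrite NegzE -exprnN -[_^-1]mul1r; apply: Kdivr => //; apply: KX.
have isom : normp (ang iota a ^+ (d * N) - 1) = normp (ang iota a - 1).
  rewrite subrX1 normpM; set S := \sum_(i < _) _.
  suff -> : normp S = 1 by rewrite mulr1.
  have dNp : normp ((d * N)%:R : C) = 1.
    by rewrite normp_ndvdn// -prime_coprime// coprime_sym coprimeMl dp.
  rewrite -dNp; apply: normp_isosceles; rewrite dNp.
  have -> : (d * N)%:R = \sum_(i < d * N) (1 : C) by rewrite sumr_const card_ord.
  rewrite /S -sumrB; apply: normp_sum_lt => // i _.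
  rewrite subrX1 normpM; apply: le_lt_trans ang1.
  rewrite ler_piMr ?normp_ge0//; apply: normp_sum_le => // j _.
  by rewrite normpX angN expr1n.
by rewrite -isom; apply: ramification_gap; rewrite ?isom//; apply: KB.
Qed.

End Ramification.

(** * Convergence of the operator *)

(** The first term is left out of the bound: in the application it contains the
    factor [2 / (s - 1)], which may be large. *)
Lemma series_geom_tail_cvg (u : nat -> C) (q : R) : 0 <= q < 1 ->
  (forall n, normp (u n.+1) <= q ^+ n) -> converges (series u).
Proof.
move=> q01 uq; have [l lE] := series_geom q01 (uq : forall n, normp ((u \o S) n) <= _).
exists (u 0%N + l); apply/cvg_seq_normpP => eps /(exp_small q01)[N hN].
exists N.+1 => -[//|n] nN; apply: le_lt_trans (hN n nN); apply: le_trans (lE n).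
rewrite /series /= big_ltn// big_add1 /= opprD addrA [u 0%N + l]addrC.
by rewrite addrK.
Qed.

Lemma series_sumB (u w : nat -> C) (q : R) : 0 <= q < 1 ->
  (forall n, normp (u n) <= q ^+ n) -> (forall n, normp (w n) <= q ^+ n) ->
  series_sum u - series_sum w = series_sum (fun n => u n - w n).
Proof.
move=> q01 uq wq; apply/esym/(series_sumE q01) => n.
rewrite /series /= sumrB opprD addrACA -opprD; apply: normpB_le.
  exact: series_sum_geom.
exact: series_sum_geom.
Qed.

(** The product in [Pcoef] has norm at most 1, the factorial costs
    [exp_rate ^+ n] and the power of [omegav] gains [rho ^+ n]. *)
Lemma normp_Pcoef (iota : {rmorphism algC -> C}) n a s (rho : R) :
  normp s <= 1 -> normp (omegav iota a)^-1 <= rho ->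
  normp (Pcoef iota n.+1 a s) <= (rho * exp_rate) ^+ n.+1.
Proof.
move=> s1 om; have rho0 : 0 <= rho by apply: le_trans om; exact: normp_ge0.
case: n => [|n].
  by rewrite expr1; apply: le_trans om _; rewrite ler_peMr// exp_rate_ge1.
rewrite [normp _]normpM -[leRHS]mulr1 ler_pM ?normp_ge0//.
  rewrite invfM normpM [(rho * _) ^+ _]exprMn mulrC ler_pM ?normp_ge0 ?normp_fact_inv//.
  by rewrite normpV normpX -exprVn -normpV lerXn2r ?nnegrE ?normp_ge0.
apply: normp_prod_le1 => j _; apply: normpD_le; last exact: normp_nat_le1.
by apply: normpB_le; rewrite ?normp1.
Qed.

Lemma zeta_minus_angpow_power_series (iota : {rmorphism algC -> C}) a s (rho : R) :
  odd p -> 1 < normp a -> normp s <= 1 -> 0 < rho -> rho * exp_rate < 1 ->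
  normp (ang iota a - 1) <= rho -> normp a^-1 <= rho ->
  exists c, (forall m, normp (c m) <= (rho * exp_rate) ^+ m) /\
    power_series_at (fun t => zeta_pE iota t a - angpow iota a (1 - t)) s c
      (rho * exp_rate).
Proof.
move=> hodd a1 s1 rho0 rho_conv ang_rho a_rho.
have theta01 : 0 <= rho * exp_rate < 1.
  by rewrite rho_conv mulr_ge0// ltW// exp_rate_gt0.
have rho01 : 0 < rho <= 1.
  rewrite rho0/=; apply: le_trans (ltW rho_conv).
  by rewrite ler_peMr ?exp_rate_ge1// ltW.
have a0 : a != 0 by rewrite -normp_eq0 gt_eqF// (lt_trans ltr01).
have om_rho : normp (omegav iota a)^-1 <= rho.
  by rewrite normpV normp_omegav// -normpV.
set x0 := ang iota a - 1 in ang_rho *; set u := (omegav iota a)^-1 in om_rho *.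
have [M MS] := alternating_moments hodd rho01 ang_rho om_rho.
have x0r n : normp (x0 ^+ n) <= rho ^+ n.
  by rewrite normpX lerXn2r ?nnegrE ?normp_ge0// ltW.
apply: (@gbinom_series_power_series _ rho0 rho_conv _ _ (fun n => M n - x0 ^+ n)).
- exact: s1.
- by move=> n; apply: normpB_le; [exact: (MS n).1|exact: x0r].
move=> h h1; have y1 : normp (1 - (s + h)) <= 1.
  by rewrite normpB_le ?normp1// normpD_le.
have -> : zeta_pE iota (s + h) a = series_sum (fun n => gbinom (1 - (s + h)) n * M n).
  apply: (@int_gbinom_series _ rho0 rho_conv _ _ _ (fun k => x0 + k%:R * u)) => //.
  - move=> k; by rewrite angpowE ang_add_nat// [1 + (x0 + _)]addrC addrK.
  - move=> k; apply: normpD_le => //; rewrite normpM; apply: le_trans om_rho.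
    by rewrite ler_piMl ?normp_ge0 ?normp_nat_le1.
  - by move=> n; exact: (MS n).1.
  - by move=> n; exact: (MS n).2.
rewrite angpowE (series_sumB theta01).
- by congr series_sum; apply/funext => n; rewrite mulrBr.
- by move=> n; apply: normp_gbinomM => //; exact: (MS n).1.
- by move=> n; apply: normp_gbinomM => //; exact: x0r.
Qed.

End PadicNorm.

Theorem corollary3p8 (R : realType) (p : nat) (hp : prime p) (hodd : odd p)
    (C : padicComplexType R p) (iota : {rmorphism algC -> C})
    (K : set C) (hK : finite_extension K)
    (e : nat) (he : is_ramification_index K e) (hlt : (e < p - 1)%N)
    (s : C) (hs : padic_int s) (hs1 : s != 1)
    (a : C) (haK : K a) (ha : 1 < normp a) :
  let f := fun s : C => zeta_pE iota s a - angpow iota a (1 - s) in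
  (forall n : nat, expD_converges n f s) /\
  converges (series (fun n : nat => Pcoef iota n a s * expD n f s)).
Proof.
move=> f; have [_ s1] := hs; have [Kdiv QK _] := hK; rewrite subn1 in hlt.
have a0 : a != 0 by rewrite -(normp_eq0 hp) gt_eqF// (lt_trans ltr01).
have [m /andP[m0 me] _] := ramification_multiple_int hp Kdiv he haK a0.
have e0 : (0 < e)%N := leq_trans m0 me.
pose rho := ram_radius R p e.
have rho0 : 0 < rho by exact: ram_radius_gt0.
have rho_conv : rho * exp_rate R p < 1 by exact: ram_radius_exp_rate.
have ep : (e < p)%N := leq_trans hlt (leq_pred p).
have ang_rho : normp (ang iota a - 1) <= rho.
  exact: (normp_ang_sub1_ramified hp Kdiv QK he).
have aV_rho : normp a^-1 <= rho.
  apply: (ramification_gap hp Kdiv he).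
    have [K1 _ Kdivr] := Kdiv; rewrite -[a^-1]mul1r.
    by apply/set_mem/Kdivr => //; apply/mem_set.
  by rewrite (normpV hp) invf_lt1// (lt_trans ltr01).
have [c [cq fc]] :=
  zeta_minus_angpow_power_series hp hodd ha s1 rho0 rho_conv ang_rho aV_rho.
have theta01 : 0 <= rho * exp_rate R p < 1.
  by rewrite rho_conv mulr_ge0// ltW// exp_rate_gt0.
have expD_ok n := expD_power_series hp n theta01 cq fc.
split=> [n|]; first by case: (expD_ok n).
apply: (series_geom_tail_cvg hp theta01) => n; rewrite (normpM hp).
rewrite -[leRHS]mulr1 ler_pM ?(normp_ge0 hp)//; last by case: (expD_ok n.+1).
have om_rho : normp (omegav iota a)^-1 <= rho.
  by rewrite (normpV hp) normp_omegav// -(normpV hp).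
apply: le_trans (normp_Pcoef hp n s1 om_rho) _.
have /andP[t0 t1] := theta01.
by rewrite exprS ler_piMl ?exprn_ge0// ltW.
Qed.
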